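(* Let $X$ be a Peano continuum and $p$ a prime. Then the set $\mathrm{Hom}(\pi_1(X),\mathbb{Z}/p)$ of group homomorphisms is either finite or of cardinality $2^{2^{\aleph_0}}$, and $\mathrm{Hom}(\pi_1(X),\mathbb{Q})$ is either countable or of cardinality $2^{2^{\aleph_0}}$.
   Context: A Peano continuum is a path connected, locally path connected, compact metrizable space. *)

(* Defs.v *)
From HB Require Import structures.
From mathcomp Require Import all_boot all_order all_algebra.
From mathcomp Require Import all_classical all_reals all_analysis.
Set Implicit Arguments. Unset Strict Implicit. Unset Printing Implicit Defensive.
Import Order.TTheory GRing.Theory Num.Theory.
Import numFieldNormedType.Exports.
Local Open Scope classical_set_scope.
Local Open Scope ring_scope.

Section Peano.
Variables (R : realType) (X : topologicalType).

Definition unit_interval : set R := [set t | 0 <= t <= 1].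

(* f is a path in X (only its restriction to [0,1] matters) *)
Definition is_path (f : R -> X) : Prop := {within unit_interval, continuous f}.

Definition path_connected_set (A : set X) : Prop :=
  forall x y, A x -> A y -> exists f : R -> X,
    [/\ is_path f, f 0 = x, f 1 = y & forall t, unit_interval t -> A (f t)].

Definition path_connected : Prop := path_connected_set [set: X].

Definition locally_path_connected : Prop :=
  forall (x : X) (U : set X), nbhs x U ->
    exists V : set X, [/\ open V, V x, V `<=` U & path_connected_set V].

Definition is_loop (x0 : X) (f : R -> X) : Prop :=
  [/\ is_path f, f 0 = x0 & f 1 = x0].

Definition loop_homotopic (x0 : X) (f g : R -> X) : Prop :=
  exists H : R * R -> X,
    [/\ {within [set st | unit_interval st.1 /\ unit_interval st.2],
          continuous H},
        forall t, unit_interval t -> H (t, 0) = f t,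
        forall t, unit_interval t -> H (t, 1) = g t &
        forall s, unit_interval s -> H (0, s) = x0 /\ H (1, s) = x0].

Definition path_concat (f g : R -> X) : R -> X :=
  fun t => if t <= 2^-1 then f (2 * t) else g (2 * t - 1).

Definition loop_class (x0 : X) (f : R -> X) : set (R -> X) :=
  [set g | is_loop x0 g /\ loop_homotopic x0 f g].

Definition pi1_set (x0 : X) : set (set (R -> X)) :=
  [set C | exists f, is_loop x0 f /\ C = loop_class x0 f].

Definition pi1 (x0 : X) : Type := {C : set (R -> X) | pi1_set x0 C}.

(* group homomorphisms pi_1(X, x0) -> G into an (additive, abelian) group G,
   the group law of pi_1 being [f][g] = [f . g] *)
Definition pi1_hom (x0 : X) (G : zmodType) : set (pi1 x0 -> G) :=
  [set psi | forall (a b c : pi1 x0) (f g : R -> X),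
     is_loop x0 f -> is_loop x0 g ->
     proj1_sig a = loop_class x0 f -> proj1_sig b = loop_class x0 g ->
     proj1_sig c = loop_class x0 (path_concat f g) ->
     psi c = psi a + psi b].

End Peano.

(* Peano continuum: path connected, locally path connected, compact
   metrizable space (metrizability is built in by taking a metric space). *)
Definition peano_continuum (R : realType) (X : metricType R) : Prop :=
  [/\ compact [set: X], path_connected R X & locally_path_connected R X].

(* Main.v *)
Require Import Defs.
From HB Require Import structures.
From mathcomp Require Import all_boot all_order all_algebra.
From mathcomp Require Import all_classical all_reals all_analysis.
From mathcomp Require Import ring lra.
Set Implicit Arguments. Unset Strict Implicit.
Unset Printing Implicit Defensive.
Import Order.TTheory GRing.Theory Num.Theory.
Import numFieldNormedType.Exports.
Local Open Scope classical_set_scope.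

(** By change of base point, the homomorphisms from pi_1(X) to a countable field
    K are the restrictions to loops of the K-valued functionals on all paths of
    X that are additive under concatenation and invariant under homotopy rel
    endpoints.

    Suppose first that for some d > 0 every such functional vanishes on the
    closed paths contained in a ball of radius d.  By compactness and uniform
    local path connectedness a functional is then determined on loops by its
    values on finitely many short edges joining the points of a finite net, so
    that Hom(pi_1(X), K) embeds in a finite power of K.

    Otherwise compactness yields a point x and loops g_n at x, with diameters
    tending to 0, each of them detected by a functional.  To a set A of natural
    numbers associate the infinite concatenation of the g_n with n in A.  A
    linear relation between finitely many such loops, modulo the relations valid
    for all functionals, is witnessed by finitely many homotopies, hence defines
    an analytic relation on the A's; it has the Baire property.  If it held for
    generic A's, it would still hold after changing one bit n of one of them,
    which changes the value of a functional detecting g_n: the relation is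
    meager.  Mycielski's theorem then gives continuum many A's whose loops are
    linearly independent, and linear functionals realise all 2^(2^aleph_0)
    assignments of values in {0, 1} to these loops. *)

(** * Category in sequence spaces *)

Section Category.
Variable T : countType.
Implicit Types (p q r : seq T) (a : nat -> T) (Phi : set (nat -> T)).

(** A string stands for the cylinder of sequences extending it, [T] being discrete. A dense [D]
    gives the dense open set of the [a] with [meets a D], and [generic] is membership in a countable
    intersection of such sets. *)
Definition dense_strings (D : set (seq T)) :=
  forall p, exists2 q, prefix p q & D q.

Definition meets a (D : set (seq T)) := exists m, D (mkseq a m).

Definition generic (D : nat -> set (seq T)) a := forall n, meets a (D n).

Definition extends a p := mkseq a (size p) = p.

(** Meagerness of [Phi] relative to the cylinder over [p]: a dense G-delta set avoids [Phi]
    there. *)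
Definition meager_in p Phi := exists D : nat -> set (seq T),
  (forall n, dense_strings (D n)) /\
  forall a, extends a p -> generic D a -> ~ Phi a.

Lemma mkseq_prefix a m n : (m <= n)%N -> prefix (mkseq a m) (mkseq a n).
Proof.
move=> mn; apply/prefixP; exists (mkseq (fun i => a (m + i)%N) (n - m)).
by rewrite -{1}(subnKC mn) /mkseq iotaD map_cat -{1}[(0 + m)%N]addn0 iotaDl
  -map_comp.
Qed.

Lemma extends_mkseq a m : extends a (mkseq a m).
Proof. by rewrite /extends size_mkseq. Qed.

Lemma extends_prefix a p q : prefix p q -> extends a q -> extends a p.
Proof.
move=> /prefixP[s ->]; rewrite /extends size_cat => /(congr1 (take (size p))).
by rewrite take_size_cat// /mkseq -map_take take_iota (minn_idPl (leq_addr _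
  _)).
Qed.

Lemma mkseqP a a' m : (forall i, (i < m)%N -> a' i = a i) <->
  mkseq a' m = mkseq a m.
Proof.
split=> [h|h i im]; last first.
  by have := congr1 (fun s => nth (a' i) s i) h; rewrite !nth_mkseq.
by apply/eq_in_map => i; rewrite mem_iota add0n => /andP[_ /h].
Qed.

Lemma meager_in_prefix p q Phi : prefix p q ->
  meager_in p Phi -> meager_in q Phi.
Proof.
by move=> pq [D [dD DP]]; exists D; split=> // a /(extends_prefix pq)/DP.
Qed.

(** Lets a proof impose density conditions indexed by any countable type; numbers that code no index
    get [setT]. *)
Lemma generic_reindex (J : countType) (D : J -> set (seq T)) :
  (forall j, dense_strings (D j)) ->
  exists D' : nat -> set (seq T), (forall n, dense_strings (D' n)) /\
    forall a, generic D' a -> forall j, meets a (D j).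
Proof.
move=> dD; exists (fun n => if unpickle n is Some j then D j else setT).
split=> [n|a ga j]; last by have := ga (pickle j); rewrite pickleK.
case: unpickle => [j|p]; first exact: dD.
by exists p => //; exact: prefix_refl.
Qed.

(** The witnesses of meagerness are fixed in advance, one family per string, so that one generic
    sequence can meet those of all strings at once. *)
Lemma meager_choice Phi : exists E : seq T -> nat -> set (seq T),
  (forall p n, dense_strings (E p n)) /\
  (forall p, meager_in p Phi -> forall a, extends a p -> generic (E p) a ->
     ~ Phi a).
Proof.
have /choice[E EP] : forall p, exists D : nat -> set (seq T),
    (forall n, dense_strings (D n)) /\ (meager_in p Phi ->
     forall a, extends a p -> generic D a -> ~ Phi a).
  move=> p; have [[D [dD DP]]|nm] := pselect (meager_in p Phi).
    by exists D.
  by exists (fun=> setT); split=> // n q; exists q => //; exact: prefix_refl.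
by exists E; split => p; [have [] := EP p|have [_] := EP p].
Qed.

Lemma meager_bigcup p (Phi : nat -> set (nat -> T)) :
  (forall n, meager_in p (Phi n)) -> meager_in p (\bigcup_n Phi n).
Proof.
move=> /choice[D DP].
have [|D' [dD' D'P]] := @generic_reindex (nat * nat)%type
  (fun j => D j.1 j.2).
  by case=> n m; have [+ _] := DP n; exact.
exists D'; split=> // a ap /D'P ga [n _]; have [_] := DP n; apply => //.
by move=> m; exact: (ga (n, m)).
Qed.

(** A form of Banach's category theorem: there are countably many strings, so local witnesses can be
    merged, and [D0] sends a generic sequence into a cylinder where [Phi] is meager. *)
Lemma meager_local p Phi :
  (forall q, prefix p q -> exists2 r, prefix q r & meager_in r Phi) ->
  meager_in p Phi.
Proof.
move=> h; have [E [dE EP]] := meager_choice Phi.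
(* The first alternative makes [D0] dense away from [p]; prefixes of a sequence extending [p] are
   comparable with [p] and must use the second. *)
pose D0 : set (seq T) :=
  [set r | ~~ prefix p r && ~~ prefix r p \/ meager_in r Phi].
have [|D [dD DP]] := @generic_reindex (option (seq T * nat))
  (fun o => if o is Some j then E j.1 j.2 else D0).
  case=> [[q n]|]; first exact: dE.
  move=> q; case: (boolP (prefix p q)) => [pq|npq].
    by have [r qr mr] := h _ pq; exists r => //; right.
  case: (boolP (prefix q p)) => [qp|nqp].
    have [r pr mr] := h _ (prefix_refl p); exists r; last by right.
    exact: prefix_trans pr.
  by exists q; [exact: prefix_refl|left; rewrite npq].
exists D; split=> // a ap ga.
have [m [|mm]] := DP _ ga None; last first.
  by apply: EP mm _ (extends_mkseq _ _) _ => n; exact: (DP _ ga (Some (_, n))).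
rewrite -ap => /andP[]; case: (leqP m (size p)) => [mp|/ltnW mp].
  by rewrite (mkseq_prefix a mp).
by rewrite (mkseq_prefix a mp).
Qed.

(* Nikodym's theorem that the Souslin operation preserves the Baire property,
   for the projection of a relation [C] that is closed in the sense of [Ccl];
   the [B k] play the role of countable covers by sets of diameter [2^-k]. *)
Theorem analytic_baire (Y : Type) (B : nat -> nat -> set Y)
    (C : (nat -> T) -> set Y)
    (Bcov : forall k a y, C a y -> exists j, B k j y)
    (Ccl : forall a (x : nat -> nat), (forall k, exists a' y,
       [/\ forall i, (i < k)%N -> a' i = a i,
           forall i, (i < k)%N -> B i (x i) y & C a' y]) -> exists y, C a y) :
  exists D : nat -> set (seq T), (forall n, dense_strings (D n)) /\
    forall a, generic D a -> (exists y, C a y) ->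
    exists m, forall a', generic D a' -> (forall i, (i < m)%N -> a' i = a i) ->
    exists y, C a' y.
Proof.
(* A Souslin scheme: [x] prescribes the cells of the witness at the levels below [size x]. *)
pose S (x : seq nat) : set (nat -> T) := [set a | exists y,
  (forall i, (i < size x)%N -> B i (nth 0%N x i) y) /\ C a y].
have S_rcons x : S x `<=` \bigcup_n S (rcons x n).
  move=> a [y [yB Cy]]; have [j yj] := Bcov (size x) _ _ Cy.
  exists j => //; exists y; split=> // i; rewrite size_rcons ltnS nth_rcons.
  by case: ltngtP => // [/yB//|->].
pose M p x := meager_in p (S x).
have /choice[E EP] := fun x => meager_choice (S x).
(* Meeting [E1 x] decides on a prefix whether [S x] is meager there or non-meager in every cylinder
   inside. In the second case [E2 x] finds a next cell [n] such that [S (rcons x n)] is again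
   non-meager everywhere inside. *)
pose E1 x : set (seq T) :=
  [set q | M q x \/ forall r, prefix q r -> ~ M r x].
pose E2 x : set (seq T) :=
  [set q | M q x \/ exists n, forall r, prefix q r -> ~ M r (rcons x n)].
have dE1 x : dense_strings (E1 x).
  move=> p; have [[r [pr Mr]]|h] := pselect (exists r, prefix p r /\ M r x).
    by exists r => //; left.
  exists p; first exact: prefix_refl.
  by right=> r pr Mr; apply: h; exists r.
have dE2 x : dense_strings (E2 x).
  move=> p; have [[r [pr Mr]]|h] := pselect (exists r, prefix p r /\ M r x).
    by exists r => //; left.
  (* If no extension of [p] settles [E2 x], each [S (rcons x n)] is meager in cylinders densely
     below [p], hence in [p]; so is the union, which contains [S x]. *)
  apply: contrapT => nh; apply: h; exists p; split; first exact: prefix_refl.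
  have [D [dD DP]] : meager_in p (\bigcup_n S (rcons x n)).
    apply: meager_bigcup => n; apply: meager_local => q pq.
    apply: contrapT => nr; apply: nh; exists q => //; right;
      exists n => r qr Mr.
    by apply: nr; exists r.
  by exists D; split=> // a ap ga /S_rcons; exact: DP.
have [|D [dD DP]] := @generic_reindex
    (seq T * seq nat * nat + seq nat + seq nat)%type (fun j => match j with
    | inl (inl (p, x, n)) => E x p n | inl (inr x) => E1 x | inr x => E2 x end).
  by case=> [[[[p x] n]|x]|x] //; have [+ _] := EP x; exact.
exists D; split=> // a ga [y Cy].
have nM b : generic D b -> forall m x, M (mkseq b m) x -> ~ S x b.
  move=> /DP gb m x mM; have [_] := EP x; apply => //; first exact: mM.
    exact: extends_mkseq.
  by move=> n; exact: (gb (inl (inl (_, _, n)))).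
(* [a] itself lies in [S [::]], which rules out the meager alternative of [E1]. *)
have [m Hm] : exists m, forall r, prefix (mkseq a m) r -> ~ M r [::].
  have [m [Mm|]] := DP _ ga (inl (inr [::])); last by exists m.
  by exfalso; apply: nM Mm _ => //; exists y.
exists m => b gb ba.
(* A state is a prefix length of [b] with a string of cells. Good states can be prolonged forever by
   [E2], and this builds the branch [x] for [b]. *)
pose good (s : nat * seq nat) :=
  forall r, prefix (mkseq b s.1) r -> ~ M r s.2.
have step s : exists s', good s -> [/\ good s', (s.1 < s'.1)%N &
    exists n, s'.2 = rcons s.2 n].
  have [gs|] := pselect (good s); last by exists s.
  have [m' [Mm'|[n nP]]] := DP _ gb (inr s.2).
    exfalso; apply: (gs (mkseq b (maxn s.1 m'))).
      by apply: mkseq_prefix; rewrite leq_maxl.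
    by apply: meager_in_prefix Mm'; apply: mkseq_prefix; rewrite leq_maxr.
  exists ((maxn s.1 m').+1, rcons s.2 n) => _; split=> //=.
  - move=> r rr; apply: nP; apply: prefix_trans rr.
    by apply: mkseq_prefix; rewrite ltnW// ltnS leq_maxr.
  - by rewrite ltnS leq_maxl.
  - by exists n.
have {step}[f fP] := choice step.
pose s k := iter k f (m, [::]).
have gs k : good (s k).
  elim: k => [|k IH]; last by have [] := fP _ IH.
  by move=> r /=; have /mkseqP -> := ba; exact: Hm.
have s1 k : (k <= (s k).1)%N.
  elim: k => // k IH; have [_ h _] := fP _ (gs k); exact: leq_trans h.
have s2 k : size (s k).2 = k.
  by elim: k => // k IH; have [_ _ [n /= ->]] := fP _ (gs k);
    rewrite size_rcons IH.
pose x i := nth 0%N (s i.+1).2 i.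
have xP i k : (i < k)%N -> nth 0%N (s k).2 i = x i.
  elim: k => // k IH; rewrite ltnS leq_eqVlt => /predU1P[->//|ik].
  have [_ _ [n /= ->]] := fP _ (gs k); rewrite nth_rcons s2 ik; exact: IH.
apply: (Ccl b x) => k; apply: contrapT => h.
(* A set that is non-meager in this cylinder is nonempty there; an element of it is the
   approximation required by [Ccl]. *)
apply: (gs k (mkseq b (s k).1)); first exact: prefix_refl.
exists (fun=> setT); split=> [n q|c cb _ [z [zB Cz]]].
  by exists q => //; exact: prefix_refl.
apply: h; exists c, z; split=> // [i ik|i ik].
  move: cb; rewrite /extends size_mkseq => /mkseqP; apply.
  exact: leq_trans ik (s1 k).
by rewrite -(xP i k)//; apply: zB; rewrite s2.
Qed.

Definition update a N t : nat -> T := fun i => if i == N then t else a i.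

(** Density survives pulling back along the overwriting of one term, and there are countably many
    such changes to handle. *)
Lemma generic_update (D : nat -> set (seq T)) :
  (forall n, dense_strings (D n)) ->
  exists D' : nat -> set (seq T), (forall n, dense_strings (D' n)) /\
    forall a, generic D' a -> generic D a /\ forall N t, generic D (update a N
      t).
Proof.
move=> dD.
(* The bound [N < size q] makes [set_nth] replace a letter already present, without padding. *)
pose E (n N : nat) (t : T) : set (seq T) :=
  [set q | (N < size q)%N /\ D n (set_nth t q N t)].
have [|D' [dD' D'P]] := @generic_reindex (nat + nat * nat * T)%type
  (fun j => match j with inl n => D n | inr (n, N, t) => E n N t end).
  case=> [n|[[n N] t]] //.
  move=> p; pose p' := p ++ nseq N.+1 t.
  have Np' : (N < size p')%N by rewrite size_cat size_nseq ltn_addl.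
  have [q /prefixP[w ->] Dq] := dD n (set_nth t p' N t).
  exists (p' ++ w); first by rewrite /p' -catA prefix_prefix.
  split; first by rewrite size_cat ltn_addr.
  suff -> : set_nth t (p' ++ w) N t = set_nth t p' N t ++ w by [].
  rewrite !set_nthE size_cat Np' ltn_addr//= take_cat Np' drop_cat -catA /=.
  case: ltnP => // pN; rewrite (_ : (N.+1 - size p')%N = 0%N) ?drop0.
    by rewrite drop_oversize.
  by apply/eqP; rewrite subn_eq0.
exists D'; split=> // a /D'P ga; split=> [n|N t n]; first exact: (ga (inl n)).
have [m [+ Dm]] := ga (inr (n, N, t)); rewrite size_mkseq => Nm.
exists m; suff <- : set_nth t (mkseq a m) N t = mkseq (update a N t) m by [].
apply: (@eq_from_nth _ t) => [|i].
  by rewrite size_set_nth !size_mkseq; apply/maxn_idPr.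
rewrite size_set_nth size_mkseq (maxn_idPr _)// => im.
by rewrite nth_set_nth/= !nth_mkseq// /update; case: ifP.
Qed.

End Category.

(** * Perfect sets of mutually generic binary sequences *)

Section Fusion.
Variables (n : nat -> nat) (D : forall j, set (seq ((n j).-tuple bool))).
Arguments D : clear implicits.
Hypothesis dD : forall j, dense_strings (D j).

Definition columns (S : Type) m (s : m.-tuple S) (sigma : S -> nat -> bool) k :=
  [tuple sigma (tnth s i) k | i < m].

(** The entries of [s] are distinct, so their values from [l] on can be chosen independently; they
    are read off an extension of the current columns lying in [D j]. *)
Lemma fuse1 (S : eqType) l (sigma : S -> nat -> bool) j (s : (n j).-tuple S) :
  uniq s -> exists l' sigma', [/\ (l <= l')%N,
    forall x k, (k < l)%N -> sigma' x k = sigma x k &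
    exists2 l0, (l0 <= l')%N & D j (mkseq (columns s sigma') l0)].
Proof.
move=> us; have [q /prefixP[w qE] Dq] := @dD j (mkseq (columns s sigma) l).
pose t0 := nseq_tuple (n j) false.
(* The row of [x] is found by its index in [s]; outside [s] or beyond [q] the value is [false]. *)
pose sigma' x k := if (k < l)%N then sigma x k else
  nth false (nth t0 q k) (index x s).
exists (size q), sigma'; split.
- by rewrite qE size_cat size_mkseq leq_addr.
- by move=> x k kl; rewrite /sigma' kl.
- exists (size q) => //; suff -> : mkseq (columns s sigma') (size q) = q by [].
  apply: (@eq_from_nth _ t0) => [|k]; rewrite size_mkseq// => kq.
  rewrite nth_mkseq//; apply: eq_from_tnth => i; rewrite tnth_mktuple /sigma'.
  case: ifP => kl.
    by rewrite qE nth_cat size_mkseq kl nth_mkseq// tnth_mktuple.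
  by rewrite (tnth_nth (tnth s i)) index_uniq ?size_tuple// (tnth_nth false).
Qed.

Lemma eq_columns (S : Type) m (s : m.-tuple S) sigma sigma' l :
  (forall x k, (k < l)%N -> sigma' x k = sigma x k) ->
  mkseq (columns s sigma') l = mkseq (columns s sigma) l.
Proof.
move=> h; apply/eq_in_map => k; rewrite mem_iota => /andP[_ kl].
by apply: eq_from_tnth => i; rewrite !tnth_mktuple h.
Qed.

(** The tuples are treated in turn; a later step changes values only from [l1] on, so what was
    achieved below that length persists. *)
Lemma fuse_all (S : eqType) l (sigma : S -> nat -> bool)
    (L : seq {j : nat & (n j).-tuple S}) :
  exists l' sigma', [/\ (l <= l')%N,
    forall x k, (k < l)%N -> sigma' x k = sigma x k &
    forall r, r \in L -> uniq (tagged r) ->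
      exists2 l0, (l0 <= l')%N & D (tag r) (mkseq (columns (tagged r) sigma')
        l0)].
Proof.
elim: L => [|r L [l1 [sigma1 [ll1 e1 h1]]]]; first by exists l, sigma.
have [ur|nur] := boolP (uniq (tagged r)); last first.
  exists l1, sigma1; split=> // r'; rewrite in_cons => /predU1P[->|];
    last exact: h1.
  by move=> ur; rewrite ur in nur.
have [l2 [sigma2 [ll2 e2 h2]]] := fuse1 l1 sigma1 ur.
exists l2, sigma2; split; first exact: leq_trans ll2.
  by move=> x k kl; rewrite e2 ?e1//; exact: leq_trans ll1.
move=> r'; rewrite in_cons => /predU1P[->//|r'L ur'].
have [l0 l01 Dl0] := h1 _ r'L ur'; exists l0; first exact: leq_trans ll2.
suff -> : mkseq (columns (tagged r') sigma2) l0 =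
          mkseq (columns (tagged r') sigma1) l0 by [].
by apply: eq_columns => x k kl; apply: e2; exact: leq_trans l01.
Qed.

(* Mycielski's theorem, by fusion: at stage [m] the strings of length [m] carry
   approximations [sigma], lengthened until all tuples of distinct strings meet
   the dense sets handled so far. *)
Theorem perfect_generic : exists A : (nat -> bool) -> nat -> bool,
  forall j (alpha : 'I_(n j) -> nat -> bool), injective alpha ->
  meets (fun k => [tuple A (alpha i) k | i < n j]) (D j).
Proof.
pose state := (nat * (seq bool -> nat -> bool))%type.
(* [st.1] bounds the positions already final: below it, the new approximation at a string copies
   that of its prefix of length [m]. *)
pose next m (st st' : state) := [/\ (st.1 <= st'.1)%N, (m < st'.1)%N,
  forall t k, (k < st.1)%N -> st'.2 t k = st.2 (take m t) k &
  forall j (s : (n j).-tuple (seq bool)), (j <= m)%N -> uniq s ->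
    (forall i, size (tnth s i) = m.+1) ->
    exists2 l, (l <= st'.1)%N & D j (mkseq (columns s st'.2) l)].
have /choice[step stepP] : forall mst : nat * state, exists st',
    next mst.1 mst.2 st'.
  case=> m [l sigma] /=.
  (* All tuples of strings of length [m.+1], for the sets [D j] with [j <= m]; strings of fixed
     length form a finite type and can be listed. *)
  pose L : seq {j : nat & (n j).-tuple (seq bool)} := flatten [seq
    [seq Tagged (fun j => (n j).-tuple (seq bool)) (map_tuple val s)
      | s <- enum {: (n j).-tuple (m.+1.-tuple bool)}] | j <- iota 0 m.+1].
  have [l' [sigma' [ll' e' h']]] := fuse_all l (fun t => sigma (take m t)) L.
  exists (maxn l' m.+1, sigma'); split => /=.
  - by rewrite (leq_trans ll')// leq_maxl.
  - by rewrite leq_maxr.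
  - by move=> t k kl; rewrite e'.
  - move=> j s jm us sm.
    have [|l0 l0l D0] := h' (Tagged (fun j => (n j).-tuple (seq bool)) s) _ us.
      apply/flatten_mapP; exists j; first by rewrite mem_iota.
      apply/mapP; exists [tuple insubd [tuple of nseq m.+1 false] (tnth s i) |
        i < n j].
        by rewrite mem_enum.
      congr (Tagged _ _); apply: eq_from_tnth => i.
      by rewrite tnth_map tnth_mktuple val_insubd sm eqxx.
    by exists l0 => //; rewrite (leq_trans l0l)// leq_maxl.
pose F := fix F m : state :=
  if m is m'.+1 then step (m', F m') else (0%N, fun _ _ => false).
have FP m : next m (F m) (F m.+1) by exact: (stepP (m, F m)).
(* Bit [k] is final at stage [k.+1], by the second clause of [next]. *)
pose A (alpha : nat -> bool) k := (F k.+1).2 (mkseq alpha k.+1) k.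
have F_le m M : (m <= M)%N -> ((F m).1 <= (F M).1)%N.
  elim: M => [|M IH]; first by rewrite leqn0 => /eqP ->.
  rewrite leq_eqVlt => /predU1P[->//|/IH]; move/leq_trans; apply.
  by case: (FP M).
have F_stab alpha k m M : (m <= M)%N -> (k < (F m).1)%N ->
    (F M).2 (mkseq alpha M) k = (F m).2 (mkseq alpha m) k.
  move=> + kl; elim: M => [|M IH]; first by rewrite leqn0 => /eqP ->.
  rewrite leq_eqVlt => /predU1P[->//|mM]; rewrite -IH//; clear IH.
  have [_ _ e _] := FP M; rewrite e; last by apply: (leq_trans kl); exact: F_le.
  by rewrite /mkseq -map_take take_iota (minn_idPl _).
have AE alpha k m : (k < (F m).1)%N -> (F m).2 (mkseq alpha m) k = A alpha k.
  move=> kl; rewrite -(F_stab alpha k _ (maxn m k.+1) (leq_maxl _ _))//.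
  by rewrite (F_stab alpha k k.+1)// ?leq_maxr//; case: (FP k).
exists A => j alpha alphaI.
have /choice[d dP] : forall p : 'I_(n j) * 'I_(n j), exists k,
    p.1 != p.2 -> alpha p.1 k <> alpha p.2 k.
  move=> p; have [->|pp] := eqVneq p.1 p.2; first by exists 0%N.
  apply: contrapT => h; move/eqP: pp; apply; apply: alphaI; apply/funext => k.
  by apply: contrapT => hk; apply: h; exists k.
(* A stage that treats [D j] and at which the truncations of the [alpha i] are already distinct. *)
pose m := maxn j (\max_p d p).
pose s := [tuple mkseq (alpha i) m.+1 | i < n j].
have [_ _ _ /(_ j s)[|||l lm Dl]] := FP m.
- exact: leq_maxl.
- apply/(uniqP [::]) => i i'; rewrite !inE !size_tuple => ilt i'lt.
  rewrite -[i]/(val (Ordinal ilt)) -[i']/(val (Ordinal i'lt)) -!tnth_nth.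
  rewrite !tnth_mktuple => e; congr val; apply/eqP/negPn/negP => ne.
  apply: (dP (_, _) ne) => /=; move/mkseqP: e; apply.
  rewrite ltnS leq_max; apply/orP; right.
  exact: (leq_bigmax (Ordinal ilt, Ordinal i'lt)).
- by move=> i; rewrite tnth_mktuple size_mkseq.
exists l; suff <- : mkseq (columns s (F m.+1).2) l =
  mkseq (fun k => [tuple A (alpha i) k | i < n j]) l by [].
apply/eq_in_map => k; rewrite mem_iota => /andP[_ kl].
apply: eq_from_tnth => i; rewrite !tnth_mktuple AE//.
exact: leq_trans lm.
Qed.

End Fusion.

(** * Extension of linear functionals *)

Section LinearExtension.
Local Open Scope ring_scope.

Lemma sum_regroup (K : pzRingType) (V : lmodType K) (I : eqType)
    (l : seq (K * I)) (f : I -> V) :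
  \sum_(p <- l) p.1 *: f p.2 =
  \sum_(i <- undup [seq p.2 | p <- l]) (\sum_(p <- l | p.2 == i) p.1) *: f i.
Proof.
transitivity (\sum_(i <- undup [seq p.2 | p <- l])
    \sum_(p <- l | p.2 == i) p.1 *: f p.2).
  rewrite (exchange_big_dep xpredT)//= big_seq [RHS]big_seq.
  apply: eq_bigr => p pl; rewrite -big_filter.
  rewrite (_ : [seq i <- _ | p.2 == i] = [:: p.2]) ?big_seq1//.
  apply: perm_small_eq => //; apply: uniq_perm => //.
    by rewrite filter_uniq// undup_uniq.
  move=> i; rewrite mem_filter mem_seq1 eq_sym; case: eqVneq => //= ->.
  by rewrite mem_undup map_f.
by apply: eq_bigr => i _; rewrite scaler_suml; apply: eq_bigr => p /eqP ->.
Qed.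

Variables (K : fieldType) (E : lmodType K).
Implicit Types (G : set (E * K)) (W : set E).

(** The graph of a linear functional on a subspace; the last clause expresses single-valuedness. *)
Definition subspace_graph G := [/\ G (0, 0),
  forall a u v, G u -> G v -> G (a *: u.1 + v.1, a * u.2 + v.2) &
  forall b, G (0, b) -> b = 0].

Lemma extend_graph G0 : subspace_graph G0 ->
  exists L : E -> K, (forall a x y, L (a *: x + y) = a * L x + L y) /\
    forall u, G0 u -> L u.1 = u.2.
Proof.
(* Imposing the property on the union with [G0], rather than on [G], gives the empty chain an upper
   bound. *)
move=> gG0; pose P G := subspace_graph (G0 `|` G).
have [F FP totF|G [PG maxG]] := @Zorn_bigcup _ P.
  have [[X0 FX0]|F0] := pselect (exists X, F X); last first.
    rewrite /P (_ : \bigcup_(X in F) X = set0) ?setU0//.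
    by rewrite -subset0 => x [X FX _]; case: F0; exists X.
  have dir u v : (G0 `|` \bigcup_(X in F) X) u ->
      (G0 `|` \bigcup_(X in F) X) v ->
      exists2 X, F X & (G0 `|` X) u /\ (G0 `|` X) v.
    move=> [u0|[X FX Xu]] [v0|[Y FY Yv]].
    - by exists X0 => //; split; left.
    - by exists Y => //; split; [left|right].
    - by exists X => //; split; [right|left].
    - have [XY|YX] := totF _ _ FX FY.
        by exists Y => //; split; right => //; exact: XY.
      by exists X => //; split; right => //; exact: YX.
  have inc X u : F X -> (G0 `|` X) u -> (G0 `|` \bigcup_(X in F) X) u.
    by move=> FX [|Xu]; [left|right; exists X].
  split; first by have [+ _ _] := gG0; left.
  - move=> a u v Fu Fv; have [X FX [Xu Xv]] := dir _ _ Fu Fv.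
    by apply: (inc X) => //; have [_ + _] := FP _ FX; apply.
  - move=> b Fb; have [X FX [Xb _]] := dir _ _ Fb Fb.
    by have [_ _] := FP _ FX; exact.
have tot v : exists b, (G0 `|` G) (v, b).
  apply: contrapT => nv; have [g0 glin gfun] := PG.
  (* A vector [v] missing from the domain could be added with value 0, against maximality. *)
  pose G' := [set u | exists a x, (G0 `|` G) x /\ u = (x.1 + a *: v, x.2)].
  have GG' : G0 `|` G `<=` G'.
    by move=> x Gx; exists 0, x; rewrite scale0r addr0; case: x Gx.
  have /seteqP[G'G _] : G0 `|` G' = G'.
    by apply: setUidr; apply: subset_trans GG'; exact: subsetUl.
  apply: (maxG G').
    split; first by apply: subset_trans GG'; exact: subsetUr.
    move=> G'sG; apply: nv; exists 0; right; apply: G'sG.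
    by exists 1, (0, 0); rewrite /= scale1r add0r.
  have -> : P G' = subspace_graph G'.
    by rewrite /P; congr subspace_graph; apply/seteqP; split=> // x; right.
  split; first exact: GG'.
  - move=> a _ _ [b [x [Gx ->]]] [c [y [Gy ->]]]; exists (a * b + c).
    exists (a *: x.1 + y.1, a * x.2 + y.2); split;
      first exact: (glin _ _ _ Gx Gy).
    by rewrite /= scalerDr scalerDl scalerA addrACA.
  - move=> b [a [[x c] [Gx [/= xv ->]]]]; have [a0|a0] := eqVneq a 0.
      by apply: gfun; move: xv; rewrite a0 scale0r addr0 => ->.
    exfalso; apply: nv; exists (- a^-1 * c).
    have := glin (- a^-1) _ _ Gx g0; rewrite /= !addr0.
    suff -> : - a^-1 *: x = v by [].
    apply: (scalerI a0); rewrite scalerA mulrN divff// scaleN1r.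
    by apply/eqP; rewrite eq_sym -subr_eq0 opprK addrC -xv.
have {tot}[L LG] := choice tot; have [g0 glin gfun] := PG.
have LE v b : (G0 `|` G) (v, b) -> L v = b.
  move=> Gvb; have := glin (- 1) _ _ (LG v) Gvb.
  rewrite /= scaleN1r addNr => /gfun; rewrite mulN1r addrC => /subr0_eq.
  by move->.
exists L; split=> [a x y|[v b] G0u]; last by apply: LE; left.
by apply: LE; exact: (glin a (x, L x) (y, L y)).
Qed.

(** Independence of the [e i] modulo [W] makes the prescription 0 on [W] and [u i] at [e i]
    single-valued on the span; [extend_graph] does the rest. *)
Theorem linear_extension (I : eqType) W (e : I -> E) (u : I -> K) :
  W 0 -> (forall a x y, W x -> W y -> W (a *: x + y)) ->
  (forall s (c : I -> K), uniq s -> W (\sum_(i <- s) c i *: e i) ->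
     forall i, i \in s -> c i = 0) ->
  exists L : E -> K, [/\ forall a x y, L (a *: x + y) = a * L x + L y,
    forall w, W w -> L w = 0 & forall i, L (e i) = u i].
Proof.
move=> W0 Wlin ind.
pose G0 : set (E * K) := [set x | exists w (l : seq (K * I)), [/\ W w,
  x.1 = w + \sum_(p <- l) p.1 *: e p.2 & x.2 = \sum_(p <- l) p.1 * u p.2]].
have [|L [Llin LG0]] := @extend_graph G0.
  split.
  - by exists 0, [::]; rewrite !big_nil addr0.
  - move=> a _ _ [w [l [Ww -> ->]]] [w' [l' [Ww' -> ->]]].
    exists (a *: w + w'), ([seq (a * p.1, p.2) | p <- l] ++ l'); split => /=.
    + exact: Wlin.
    + rewrite big_cat big_map/= scalerDr addrACA scaler_sumr.
      by congr (_ + (_ + _)); apply: eq_bigr => p _; rewrite scalerA.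
    + rewrite big_cat big_map/= mulr_sumr.
      by congr (_ + _); apply: eq_bigr => p _; rewrite mulrA.
  - move=> b [w [l [Ww /= lw ->]]].
    pose s := undup [seq p.2 | p <- l].
    pose c i := \sum_(p <- l | p.2 == i) p.1.
    have c0 : forall i, i \in s -> c i = 0.
      apply: ind; first exact: undup_uniq.
      rewrite -sum_regroup -[X in W X](addKr w) -lw addr0 -[- w]addr0 -scaleN1r.
      exact: Wlin.
    rewrite (sum_regroup l (u : I -> K^o)) big_seq big1// => i /c0;
      rewrite /c => ->.
    by rewrite scale0r.
exists L; split=> // [w Ww|i].
  by apply: (LG0 (w, 0)); exists w, [::]; rewrite !big_nil addr0.
apply: (LG0 (e i, u i)); exists 0, [:: (1, i)]; rewrite !big_seq1.
by rewrite add0r scale1r mul1r.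
Qed.

End LinearExtension.

(** * Paths and homotopies *)

Section Continuity.
Local Open Scope ring_scope.

Lemma within_comp (U V S : topologicalType) (A : set U) (B : set V)
    (g : U -> V) (f : V -> S) : continuous g -> (forall x, A x -> B (g x)) ->
  {within B, continuous f} -> {within A, continuous (f \o g)}.
Proof.
move=> cg AB /subspace_continuousP cf; apply/subspace_continuousP => x Ax W Wx.
have := cg x _ (cf _ (AB _ Ax) _ Wx); rewrite /nbhs/= /within/=.
by apply: filterS => y h Ay; apply: h; exact: AB.
Qed.

Lemma within_eq (U S : topologicalType) (A : set U) (f g : U -> S) :
  (forall x, A x -> f x = g x) -> {within A, continuous f} ->
  {within A, continuous g}.
Proof.
by move=> fg; apply: subspace_eq_continuous => x; rewrite inE => /fg.
Qed.

Lemma within_glue (R : realType) (U S : topologicalType) (A : set U)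
    (phi : U -> R) (c : R) (f g : U -> S) : closed A -> continuous phi ->
  {within A `&` [set x | phi x <= c], continuous f} ->
  {within A `&` [set x | c <= phi x], continuous g} ->
  (forall x, A x -> phi x = c -> f x = g x) ->
  {within A, continuous (fun x => if phi x <= c then f x else g x)}.
Proof.
move=> cA cphi cf cg fg.
have cl : closed [set x | phi x <= c].
  exact: (closed_comp (fun x _ => cphi x) (@closed_le _ c)).
have cr : closed [set x | c <= phi x].
  exact: (closed_comp (fun x _ => cphi x) (@closed_ge _ c)).
have -> : A = (A `&` [set x | phi x <= c]) `|` (A `&` [set x | c <= phi x]).
  rewrite -setIUr; apply/esym/setIidl => x _.
  by case: (leP (phi x) c) => h; [left|right; exact: ltW].
apply: withinU_continuous; [exact: closedI|exact: closedI| |].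
  by apply: within_eq cf => x [_ /= ->].
apply: within_eq cg => x [Ax /= h]; case: ifP => // h'; apply/esym/fg => //.
by apply/eqP; rewrite eq_le h h'.
Qed.

Lemma within_metricP (R : realType) (X : metricType R) (U : pseudoMetricType R)
    (A : set U) (f : U -> X) : {within A, continuous f} <->
  forall x, A x -> forall e : R, 0 < e ->
    exists2 d : R, 0 < d & forall y, A y -> ball x d y -> mdist (f x) (f y) < e.
Proof.
split=> [/subspace_continuousP cf x Ax e e0|h].
  have /nbhs_ballP[d /= d0 dP] := cf x Ax _ (nbhsx_ballx (f x) _ e0).
  exists d => // y Ay xy; have := dP _ xy Ay; by rewrite ballEmdist.
apply/subspace_continuousP => x Ax W /nbhs_ballP[e /= e0 eW].
have [d d0 dP] := h _ Ax _ e0; apply/nbhs_ballP; exists d => // y xy Ay.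
by apply: eW; rewrite ballEmdist; exact: dP.
Qed.

Lemma cluster_seq (R : realType) (U : pseudoMetricType R) (A : set U)
    (u : nat -> U) : compact A -> (forall n, A (u n)) ->
  exists2 x, A x & forall e : R, 0 < e -> forall N,
    exists2 n, (N <= n)%N & ball x e (u n).
Proof.
move=> cA Au; have [|x [Ax cx]] := cA (u @ \oo) _.
  by exists 0%N => // n _; exact: Au.
exists x => // e e0 N.
have [|_ [[n /= Nn <-] xn]] := cx (u @` [set n | (N <= n)%N]) _ _ (nbhsx_ballx
  x _ e0).
  by exists N => // n /= Nn; exists n.
by exists n.
Qed.

End Continuity.

Section Homotopy.
Local Open Scope ring_scope.
Variables (R : realType) (X : topologicalType).
Implicit Types (f g h : R -> X) (phi : R -> R).
Notation I := (@unit_interval R).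

Definition unit_square : set (R * R) := [set st | I st.1 /\ I st.2].

Definition path_homotopic f g := exists H : R * R -> X,
  [/\ {within unit_square, continuous H},
      forall t, I t -> H (t, 0) = f t,
      forall t, I t -> H (t, 1) = g t &
      forall s, I s -> H (0, s) = f 0 /\ H (1, s) = f 1].

Definition rev_path f : R -> X := fun t => f (1 - t).

(** No order is assumed between [a] and [b]. Reversed and constant paths are segments too, so the
    groupoid laws become statements about segments of one path. *)
Definition segment f (a b : R) : R -> X := fun t => f (a + (b - a) * t).

Lemma closed_unit_interval : closed I.
Proof.
rewrite (_ : I = [set` `[0, 1]]); first exact: interval_closed.
by apply/seteqP; split=> t; rewrite /= in_itv.
Qed.

Lemma compact_unit_interval : compact I.
Proof.
rewrite (_ : I = [set` `[0, 1]]); first exact: segment_compact.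
by apply/seteqP; split=> t; rewrite /= in_itv.
Qed.

Lemma compact_unit_square : compact unit_square.
Proof. exact: (compact_setX compact_unit_interval compact_unit_interval). Qed.

Lemma closed_unit_square : closed unit_square.
Proof.
apply: compact_closed; last exact: compact_unit_square.
exact: norm_hausdorff.
Qed.

Lemma unit0 : I 0. Proof. by rewrite /unit_interval/= lexx ler01. Qed.
Lemma unit1 : I 1. Proof. by rewrite /unit_interval/= lexx ler01. Qed.

Lemma path_concat0 f g : path_concat f g 0 = f 0.
Proof. by rewrite /path_concat invr_ge0 ler0n mulr0. Qed.

Lemma path_concat1 f g : path_concat f g 1 = g 1.
Proof.
rewrite /path_concat ifF; last by apply/negbTE; rewrite -ltNge; lra.
by congr g; ring.
Qed.

Lemma is_path_comp f phi : continuous phi -> (forall t, I t -> I (phi t)) ->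
  is_path f -> is_path (f \o phi).
Proof. exact: within_comp. Qed.

Lemma is_path_concat f g : is_path f -> is_path g -> f 1 = g 0 ->
  is_path (path_concat f g).
Proof.
move=> pf pg fg; rewrite /is_path.
apply: (@within_glue R R X I id 2^-1 (fun t => f (2 * t)) (fun t => g (2 * t -
  1))).
- exact: closed_unit_interval.
- by move=> t; exact: cvg_id.
- apply: within_comp pf => [t|t [/= /andP[t0 t1] th]].
    by apply: cvgM; [exact: cvg_cst|exact: cvg_id].
  by apply/andP; split; lra.
- apply: within_comp pg => [t|t [/= /andP[t0 t1] th]].
    by apply: cvgB; [apply: cvgM; [exact: cvg_cst|exact: cvg_id]|exact:
      cvg_cst].
  by apply/andP; split; lra.
- by move=> t _ ->; rewrite divff// subrr.
Qed.

Lemma continuous_rev : continuous (fun t : R => 1 - t).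
Proof. by move=> t; apply: cvgB; [exact: cvg_cst|exact: cvg_id]. Qed.

Lemma is_path_rev f : is_path f -> is_path (rev_path f).
Proof.
apply: (@is_path_comp f (fun t => 1 - t)); first exact: continuous_rev.
by move=> t /andP[? ?]; apply/andP; split; lra.
Qed.

Lemma continuous_affine (a b : R) : continuous (fun t : R => a + b * t).
Proof.
move=> t; apply: cvgD; first exact: cvg_cst.
by apply: cvgM; [exact: cvg_cst|exact: cvg_id].
Qed.

Lemma unit_convex (a b t : R) : I a -> I b -> I t -> I (a + (b - a) * t).
Proof. by move=> /andP[? ?] /andP[? ?] /andP[? ?]; apply/andP; split; nra. Qed.

Lemma is_path_segment f a b : I a -> I b -> is_path f ->
  is_path (segment f a b).
Proof.
move=> Ia Ib; apply: (@is_path_comp f (fun t => a + (b - a) * t)).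
  exact: continuous_affine.
by move=> t; exact: unit_convex.
Qed.

Lemma is_path_cst (x : X) : is_path (fun _ : R => x).
Proof. by apply: continuous_subspaceT => t; exact: cvg_cst. Qed.

(** The straight-line homotopy from [phi] to [psi] stays in [0,1] by convexity and is composed with
    [f]. *)
Lemma homotopic_reparam f phi psi : is_path f ->
  continuous phi -> continuous psi ->
  (forall t, I t -> I (phi t)) -> (forall t, I t -> I (psi t)) ->
  phi 0 = psi 0 -> phi 1 = psi 1 ->
  path_homotopic (f \o phi) (f \o psi).
Proof.
move=> pf cphi cpsi Iphi Ipsi e0 e1.
exists (f \o (fun p : R * R => phi p.1 + (psi p.1 - phi p.1) * p.2)); split.
- apply: within_comp pf => [p|p [I1 I2]]; last first.
    by apply: unit_convex => //; [exact: Iphi|exact: Ipsi].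
  have c1 (q : R -> R) : continuous q -> {for p, continuous (fun p : R * R =>
    q p.1)}.
    by move=> cq; apply: continuous_comp; [exact: cvg_fst|exact: cq].
  apply: cvgD; first exact: (c1 _ cphi).
  apply: cvgM; last exact: cvg_snd.
  by apply: cvgB; [exact: (c1 _ cpsi)|exact: (c1 _ cphi)].
- by move=> t It /=; rewrite mulr0 addr0.
- by move=> t It /=; rewrite mulr1 addrC subrK.
- by move=> s Is /=; rewrite e0 e1 !subrr !mul0r !addr0.
Qed.

Lemma homotopic_eq f g : is_path f -> (forall t, I t -> f t = g t) ->
  path_homotopic f g.
Proof.
move=> pf fg; exists (f \o fst); split => //.
by apply: within_comp pf => [p|p []] //; exact: cvg_fst.
Qed.

Lemma homotopic_refl f : is_path f -> path_homotopic f f.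
Proof. by move=> pf; exact: homotopic_eq. Qed.

Lemma homotopic_ends f g : path_homotopic f g -> f 0 = g 0 /\ f 1 = g 1.
Proof.
move=> [H [_ _ Hg He]]; have [<- <-] := He 1 unit1.
by rewrite !Hg//; [exact: unit1|exact: unit0].
Qed.

Lemma continuous_pair (T U V : topologicalType) (f : T -> U) (g : T -> V) p :
  {for p, continuous f} -> {for p, continuous g} ->
  {for p, continuous (fun x => (f x, g x))}.
Proof. by move=> cf cg; exact: (cvg_pair cf cg). Qed.

Lemma homotopic_sym f g : path_homotopic f g -> path_homotopic g f.
Proof.
move=> fg; have [f0 f1] := homotopic_ends fg; case: fg => H [cH Hf Hg He].
exists (H \o (fun p => (p.1, 1 - p.2))); split => /=.
- apply: within_comp cH => [p|p [I1 /andP[? ?]]]; last first.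
    by split=> //=; apply/andP; split; lra.
  apply: continuous_pair; first exact: cvg_fst.
  by apply: cvgB; [exact: cvg_cst|exact: cvg_snd].
- by move=> t It; rewrite subr0 Hg.
- by move=> t It; rewrite subrr Hf.
- move=> s /andP[s0 s1]; rewrite -f0 -f1; apply: He.
  by apply/andP; split; lra.
Qed.

Lemma homotopic_trans g f h : path_homotopic f g -> path_homotopic g h ->
  path_homotopic f h.
Proof.
move=> fg; have [f0 f1] := homotopic_ends fg.
move: fg => [H [cH Hf Hg He]] [H' [cH' Hg' Hh He']].
exists (fun p : R * R => if p.2 <= 2^-1 then H (p.1, 2 * p.2)
   else H' (p.1, 2 * p.2 - 1)); split.
- apply: (@within_glue R (R * R)%type X unit_square snd 2^-1
    (fun p => H (p.1, 2 * p.2)) (fun p => H' (p.1, 2 * p.2 - 1))).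
  + exact: closed_unit_square.
  + by move=> p; exact: cvg_snd.
  + apply: within_comp cH => [p|p [/= [I1 /andP[t0 t1]] th]].
      apply: continuous_pair; first exact: cvg_fst.
      by apply: cvgM; [exact: cvg_cst|exact: cvg_snd].
    by split=> //; apply/andP; split => /=; lra.
  + apply: within_comp cH' => [p|p [/= [I1 /andP[t0 t1]] th]].
      apply: continuous_pair; first exact: cvg_fst.
      by apply: cvgB; [apply: cvgM; [exact: cvg_cst|exact: cvg_snd]|exact:
        cvg_cst].
    by split=> //; apply/andP; split => /=; lra.
  + by move=> [t s] [/= It _] ->; rewrite divff// subrr Hg// Hg'.
- by move=> t It /=; rewrite invr_ge0 ler0n mulr0 Hf.
- move=> t It /=; rewrite ifF; last by apply/negbTE; rewrite -ltNge; lra.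
  by rewrite mulr1 (_ : 2 - 1 = 1) ?Hh//; ring.
- move=> s /andP[s0 s1] /=; case: leP => sh.
    by apply: He; apply/andP; split; lra.
  by rewrite f0 f1; apply: He'; apply/andP; split; lra.
Qed.

Lemma homotopic_concat f f' g g' : f 1 = g 0 -> path_homotopic f f' ->
  path_homotopic g g' -> path_homotopic (path_concat f g) (path_concat f' g').
Proof.
move=> fg [H [cH Hf Hg He]] [H' [cH' Hf' Hg' He']].
exists (fun p : R * R => if p.1 <= 2^-1 then H (2 * p.1, p.2)
   else H' (2 * p.1 - 1, p.2)); split.
- apply: (@within_glue R (R * R)%type X unit_square fst 2^-1
    (fun p => H (2 * p.1, p.2)) (fun p => H' (2 * p.1 - 1, p.2))).
  + exact: closed_unit_square.
  + by move=> p; exact: cvg_fst.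
  + apply: within_comp cH => [p|p [/= [/andP[t0 t1] I2] th]].
      apply: (@continuous_pair _ _ _ (fun x : R * R => 2 * x.1) snd);
        last exact: cvg_snd.
      by apply: cvgM; [exact: cvg_cst|exact: cvg_fst].
    by split=> //; apply/andP; split => /=; lra.
  + apply: within_comp cH' => [p|p [/= [/andP[t0 t1] I2] th]].
      apply: (@continuous_pair _ _ _ (fun x : R * R => 2 * x.1 - 1) snd);
        last exact: cvg_snd.
      by apply: cvgB; [apply: cvgM; [exact: cvg_cst|exact: cvg_fst]|exact:
        cvg_cst].
    by split=> //; apply/andP; split => /=; lra.
  + move=> [t s] [/= _ Is] ->; rewrite divff// subrr.
    by have [_ ->] := He _ Is; have [-> _] := He' _ Is.
- move=> t /andP[t0 t1] /=; rewrite /path_concat; case: leP => th.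
    by apply: Hf; apply/andP; split; lra.
  by apply: Hf'; apply/andP; split; lra.
- move=> t /andP[t0 t1] /=; rewrite /path_concat; case: leP => th.
    by apply: Hg; apply/andP; split; lra.
  by apply: Hg'; apply/andP; split; lra.
- move=> s Is /=; rewrite path_concat0 path_concat1 invr_ge0 ler0n mulr0.
  have [-> _] := He _ Is; rewrite ifF; last by apply/negbTE; rewrite -ltNge;
    lra.
  by rewrite mulr1 (_ : 2 - 1 = 1) ?(proj2 (He' _ Is))//; ring.
Qed.

(** Runs linearly from [a] to [b], then from [b] to [c]; the form with [min] and [max] makes
    continuity immediate. *)
Let phi2 (a b c : R) t := a + (b - a) * Num.min (2 * t) 1
  + (c - b) * Num.max (2 * t - 1) 0.

Let continuous_phi2 a b c : continuous (phi2 a b c).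
Proof.
have c2 : continuous (fun t : R => 2 * t).
  by move=> t; apply: cvgM; [exact: cvg_cst|exact: cvg_id].
move=> t; apply: cvgD; first (apply: cvgD; first exact: cvg_cst);
  apply: cvgM; (try exact: cvg_cst).
  by apply: continuous_min; [exact: c2|exact: cvg_cst].
apply: (@continuous_max R R (fun t => 2 * t - 1) (fun=> 0));
  last exact: cvg_cst.
by apply: cvgB; [exact: c2|exact: cvg_cst].
Qed.

Let phi2_unit a b c t : I a -> I b -> I c -> I t -> I (phi2 a b c t).
Proof.
move=> Ia Ib Ic /andP[t0 t1]; rewrite /phi2.
have [th|th] := leP (2 * t) 1.
  rewrite (max_idPr _) ?mulr0 ?addr0; last lra.
  by apply: unit_convex => //; apply/andP; split; lra.
rewrite (max_idPl _); last lra.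
rewrite mulr1 [a + _]addrC subrK.
by apply: unit_convex => //; apply/andP; split; lra.
Qed.

Lemma segment_concat f a b c : I a -> I b -> I c -> is_path f ->
  path_homotopic (path_concat (segment f a b) (segment f b c)) (segment f a c).
Proof.
move=> Ia Ib Ic pf; have e t : I t ->
    (f \o phi2 a b c) t = path_concat (segment f a b) (segment f b c) t.
  move=> /andP[t0 t1]; rewrite /path_concat /segment /= /phi2.
  case: (leP t 2^-1) => th.
    rewrite (min_idPl _) ?(max_idPr _) ?mulr0 ?addr0//; lra.
  rewrite (min_idPr _) ?(max_idPl _) ?mulr1; [|lra|lra].
  by congr f; ring.
apply: (@homotopic_trans (f \o phi2 a b c)).
  apply: homotopic_sym; apply: homotopic_eq e.
  apply: is_path_comp pf; first exact: continuous_phi2.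
  by move=> t It; exact: phi2_unit.
apply: (@homotopic_reparam f (phi2 a b c) (fun t => a + (c - a) * t)) => //.
- exact: continuous_affine.
- by move=> t It; exact: phi2_unit.
- by move=> t It; exact: unit_convex.
- by rewrite /phi2 (min_idPl _) ?(max_idPr _); [ring|lra|lra].
- by rewrite /phi2 (min_idPr _) ?(max_idPl _); [ring|lra|lra].
Qed.

(** The three paths are the segments of the single path [P] cut at 1/4 and 1/2, so [segment_concat]
    regroups them. *)
Lemma homotopic_assoc f g h : is_path f -> is_path g -> is_path h ->
  f 1 = g 0 -> g 1 = h 0 ->
  path_homotopic (path_concat (path_concat f g) h)
    (path_concat f (path_concat g h)).
Proof.
move=> pf pg ph fg gh; set P := path_concat (path_concat f g) h.
have pfg : is_path (path_concat f g) by exact: is_path_concat.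
have pP : is_path P by apply: is_path_concat => //; rewrite path_concat1.
have I4 : I 4^-1 by apply/andP; split; lra.
have I2 : I 2^-1 by apply/andP; split; lra.
have P01 : path_homotopic P (segment P 0 1).
  by apply: homotopic_eq => // t _; rewrite /segment add0r subr0 mul1r.
have s1 t : I t -> segment P 0 4^-1 t = f t.
  move=> /andP[t0 t1]; rewrite /segment /P /path_concat !ifT; [|lra|lra].
  by congr f; field.
have s2 t : I t -> segment P 4^-1 2^-1 t = g t.
  move=> /andP[t0 t1]; rewrite /segment /P /path_concat ifT; last lra.
  case: leP => th; last by congr g; field.
  have -> : t = 0 by lra.
  by rewrite -fg; congr f; field.
have s3 t : I t -> segment P 2^-1 1 t = h t.
  move=> /andP[t0 t1]; rewrite /segment /P /path_concat.
  case: (leP (2^-1 + _) _) => th; last by congr h; field.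
  have -> : t = 0 by lra.
  rewrite ifF; last by apply/negbTE; rewrite -ltNge; lra.
  by rewrite -gh; congr g; field.
apply: homotopic_trans P01 _.
apply: homotopic_trans (homotopic_sym (segment_concat unit0 I4 unit1 pP)) _.
apply: homotopic_concat.
- by rewrite /segment; congr P; ring.
- by apply: homotopic_eq s1; apply: is_path_segment => //; exact: unit0.
apply: homotopic_trans (homotopic_sym (segment_concat I4 I2 unit1 pP)) _.
apply: homotopic_concat.
- by rewrite /segment; congr P; ring.
- by apply: homotopic_eq s2; exact: is_path_segment.
- by apply: homotopic_eq s3; apply: is_path_segment => //; exact: unit1.
Qed.

(** The left side joins the segments from 1 to 0 and from 0 to 1, hence is homotopic to the segment
    from 1 to 1. *)
Lemma homotopic_rev f : is_path f ->
  path_homotopic (path_concat (rev_path f) f) (fun=> f 1).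
Proof.
move=> pf; apply: homotopic_trans (homotopic_trans
  (segment_concat unit1 unit0 unit1 pf) _).
- apply: homotopic_eq.
    apply: is_path_concat => //; first exact: is_path_rev.
    by rewrite /rev_path subrr.
  move=> t _; rewrite /path_concat /segment /rev_path.
  by case: leP => _; congr f; ring.
- apply: homotopic_eq.
    by apply: is_path_segment => //; exact: unit1.
  by move=> t _; rewrite /segment subrr mul0r addr0.
Qed.

Lemma homotopic_cst_concat f : is_path f ->
  path_homotopic (path_concat (fun=> f 0) f) f.
Proof.
move=> pf; apply: homotopic_trans (homotopic_trans
  (segment_concat unit0 unit0 unit1 pf) _).
- apply: homotopic_eq.
    by apply: is_path_concat => //; exact: is_path_cst.
  move=> t _; rewrite /path_concat /segment.
  by case: leP => _; congr f; ring.
- apply: homotopic_eq.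
    by apply: is_path_segment => //; [exact: unit0|exact: unit1].
  by move=> t _; rewrite /segment subr0 mul1r add0r.
Qed.

End Homotopy.

(** * Functionals on the fundamental groupoid and change of base point *)

Section AdditiveFunctional.
Local Open Scope ring_scope.
Variables (R : realType) (X : topologicalType) (K : zmodType).
Implicit Types (f g h : R -> X) (F : (R -> X) -> K).
Notation I := (@unit_interval R).

(** A homomorphism from the fundamental groupoid to [K], presented as a function on paths. *)
Definition path_additive F :=
  (forall f g, is_path f -> is_path g -> f 1 = g 0 ->
     F (path_concat f g) = F f + F g) /\
  (forall f g, is_path f -> is_path g -> path_homotopic f g -> F f = F g).

Lemma path_additiveB F G : path_additive F -> path_additive G ->
  path_additive (fun f => F f - G f).
Proof.
move=> [FD Fh] [GD Gh]; split=> [f g pf pg fg|f g pf pg fg].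
  by rewrite FD// GD// opprD addrACA.
by rewrite (Fh f g)// (Gh f g).
Qed.

Section Theory.
Variable F : (R -> X) -> K.
Hypothesis addF : path_additive F.

Lemma additive_eq f g : is_path f -> is_path g ->
  (forall t, I t -> f t = g t) -> F f = F g.
Proof. by move=> pf pg fg; apply: addF.2 => //; exact: homotopic_eq. Qed.

Lemma additive_cst (x : X) : F (fun=> x) = 0.
Proof.
have px := @is_path_cst R X x; apply: (addrI (F (fun=> x))).
rewrite addr0 -addF.1//; congr F; apply/funext => t.
by rewrite /path_concat if_same.
Qed.

Lemma additive_rev f : is_path f -> F (rev_path f) = - F f.
Proof.
move=> pf; apply/eqP; rewrite -addr_eq0 -addF.1//; last first.
- by rewrite /rev_path subrr.
- exact: is_path_rev.
rewrite (addF.2 _ _ _ _ (homotopic_rev pf)) ?additive_cst//.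
  by apply: is_path_concat => //; [exact: is_path_rev|rewrite /rev_path subrr].
exact: is_path_cst.
Qed.

Lemma additive_segment f a b c : I a -> I b -> I c -> is_path f ->
  F (segment f a c) = F (segment f a b) + F (segment f b c).
Proof.
move=> Ia Ib Ic pf; have e : segment f a b 1 = segment f b c 0.
  by rewrite /segment; congr f; ring.
rewrite -addF.1//; [|exact: is_path_segment..].
apply/esym/addF.2; [|exact: is_path_segment|exact: segment_concat].
by apply: is_path_concat => //; exact: is_path_segment.
Qed.

Lemma additive_closed f g h : is_path f -> is_path g -> is_path h ->
  f 1 = g 0 -> f 0 = h 0 -> g 1 = h 1 ->
  F (path_concat (path_concat f g) (rev_path h)) = F f + F g - F h.
Proof.
move=> pf pg ph fg fh gh; rewrite addF.1 ?addF.1 ?additive_rev//.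
- exact: is_path_concat.
- exact: is_path_rev.
- by rewrite path_concat1 /rev_path subr0.
Qed.

End Theory.

Section FundamentalGroup.
Variable x0 : X.

Definition pi1_of f (h : is_loop x0 f) : pi1 R x0 :=
  exist _ (loop_class x0 f) (ex_intro _ f (conj h erefl)).

Lemma pi1_ofP (a : pi1 R x0) : exists f (h : is_loop x0 f), a = pi1_of h.
Proof.
case: a => C [f [h e]]; exists f, h; exact: eq_exist.
Qed.

Lemma loop_homotopicE f g : is_loop x0 f ->
  loop_homotopic x0 f g <-> path_homotopic f g.
Proof. by move=> [_ f0 f1]; rewrite /path_homotopic f0 f1. Qed.

Lemma eq_loop_class f g : is_loop x0 f -> is_loop x0 g ->
  loop_class x0 f = loop_class x0 g <-> path_homotopic f g.
Proof.
move=> lf lg; split=> [fg|fg].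
  have : loop_class x0 g g.
    split=> //; apply/loop_homotopicE => //; apply: homotopic_refl.
    by case: lg.
  by rewrite -fg => -[_ /(loop_homotopicE _ lf)].
apply/seteqP; split=> h [lh]; rewrite !loop_homotopicE// => fh;
  split=> //; apply/loop_homotopicE => //.
  exact: homotopic_trans (homotopic_sym fg) fh.
exact: homotopic_trans fg fh.
Qed.

Lemma is_loop_concat f g : is_loop x0 f -> is_loop x0 g ->
  is_loop x0 (path_concat f g).
Proof.
move=> [pf f0 f1] [pg g0 g1]; split.
- by apply: is_path_concat => //; rewrite f1 g0.
- by rewrite path_concat0.
- by rewrite path_concat1.
Qed.

Lemma hom_of_additive F : path_additive F -> exists2 psi, pi1_hom psi &
  forall f (h : is_loop x0 f), psi (pi1_of h) = F f.
Proof.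
move=> addF; have /choice[r rP] : forall a : pi1 R x0, exists f,
    is_loop x0 f /\ sval a = loop_class x0 f.
  by move=> a; have [f [h ->]] := pi1_ofP a; exists f.
have rF a f : is_loop x0 f -> sval a = loop_class x0 f -> F (r a) = F f.
  move=> lf af; have [lr ar] := rP a; apply: addF.2; first by case: lr.
    by case: lf.
  by apply/eq_loop_class => //; rewrite -ar.
exists (fun a => F (r a)) => [a b c f g lf lg af bg cfg|f h].
  rewrite (rF _ _ lf af) (rF _ _ lg bg) (rF _ _ _ cfg).
    by case: lf lg => pf _ f1 [pg g0 _]; rewrite addF.1// f1 g0.
  exact: is_loop_concat.
exact: rF.
Qed.

(** Every path is closed up to a loop at [x0] by the connecting paths [beta], and [psi] is evaluated
    on that loop. *)
Lemma additive_of_hom (beta : X -> R -> X) (psi : pi1 R x0 -> K) :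
  (forall x, [/\ is_path (beta x), beta x 0 = x0 & beta x 1 = x]) ->
  pi1_hom psi -> exists2 F, path_additive F &
  forall f (h : is_loop x0 f), F f = psi (pi1_of h).
Proof.
move=> betaP hpsi.
(* [psi] read on functions, with value 0 off the loops at [x0]. *)
pose P f := if pselect (is_loop x0 f) is left h then psi (pi1_of h) else 0.
have PE f (h : is_loop x0 f) : P f = psi (pi1_of h).
  by rewrite /P; case: pselect => // h'; rewrite (Prop_irrelevance h h').
have PD f g : is_loop x0 f -> is_loop x0 g -> P (path_concat f g) = P f + P g.
  move=> lf lg; rewrite !PE//; first exact: is_loop_concat.
  by move=> lfg; exact: (hpsi _ _ _ f g).
have Ph f g : is_loop x0 f -> is_loop x0 g -> path_homotopic f g -> P f = P g.
  move=> lf lg fg; rewrite !PE; congr psi; apply: eq_exist.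
  exact/eq_loop_class.
have P0 : P (fun=> x0) = 0.
  have l0 : is_loop x0 (fun _ : R => x0) by split=> //; exact: is_path_cst.
  apply: (addrI (P (fun=> x0))); rewrite addr0 -PD//; congr P.
  by apply/funext => t; rewrite /path_concat if_same.
pose T f := path_concat (beta (f 0)) (path_concat f (rev_path (beta (f 1)))).
have loopT f : is_path f -> is_loop x0 (T f).
  move=> pf; have [pb0 b00 b01] := betaP (f 0); have [pb1 b10 b11] :=
    betaP (f 1).
  split; last by rewrite /T !path_concat1 /rev_path subrr.
    apply: is_path_concat => //; last by rewrite path_concat0.
    apply: is_path_concat => //; first exact: is_path_rev.
    by rewrite /rev_path subr0 b11.
  by rewrite /T path_concat0.
have addPT : path_additive (P \o T).
  split=> [f g pf pg fg /=|f g pf pg fg /=].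
    rewrite -PD; [|exact: loopT..].
    apply: Ph; [apply: loopT; exact: is_path_concat| |].
      by apply: is_loop_concat; exact: loopT.
    rewrite /T path_concat0 path_concat1 -fg.
    have [pb0 b00 b01] := betaP (f 0).
    have [pb1 b10 b11] := betaP (f 1).
    have [pb2 b20 b21] := betaP (g 1).
    have rv x : is_path (beta x) -> is_path (rev_path (beta x)).
      exact: is_path_rev.
    have r0 x : rev_path (beta x) 0 = x.
      by rewrite /rev_path subr0; case: (betaP x).
    have r1 x : rev_path (beta x) 1 = x0.
      by rewrite /rev_path subrr; case: (betaP x).
    set v := path_concat g (rev_path (beta (g 1))).
    have pv : is_path v by apply: is_path_concat; rewrite ?r0//; exact: rv.
    have v0 : v 0 = f 1 by rewrite /v path_concat0.
    have pbv : is_path (path_concat (beta (f 1)) v).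
      by apply: is_path_concat => //; rewrite b11.
    have prb : is_path (path_concat f (rev_path (beta (f 1)))).
      by apply: is_path_concat; rewrite ?r0//; exact: rv.
    (* Reassociation brings [rev_path (beta (f 1))] next to [beta (f 1)], where they cancel. *)
    apply: homotopic_sym.
    apply: homotopic_trans (homotopic_assoc _ _ _ _ _) _ => //.
    - by rewrite b01 path_concat0.
    - by rewrite path_concat1 path_concat0 r1 b10.
    apply: homotopic_concat.
    - by rewrite !path_concat0.
    - exact: homotopic_refl.
    apply: homotopic_trans (homotopic_assoc _ _ _ _ _) _ => //.
    - exact: rv.
    - by rewrite path_concat0 r1 b10.
    apply: (@homotopic_trans _ _ (path_concat f v)); last first.
      apply: homotopic_sym; apply: homotopic_assoc => //; first exact: rv.
    apply: homotopic_concat.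
    - by rewrite path_concat0 r0.
    - exact: homotopic_refl.
    apply: homotopic_trans (homotopic_sym (homotopic_assoc _ _ _ _ _)) _ => //.
    - exact: rv.
    - by rewrite r1 b10.
    - by rewrite v0 b11.
    apply: homotopic_trans (homotopic_cst_concat pv).
    apply: homotopic_concat.
    - by rewrite path_concat1 v0 b11.
    - by rewrite v0 -{3}b11; exact: homotopic_rev.
    - exact: homotopic_refl.
  have [f0 f1] := homotopic_ends fg.
  apply: Ph; [exact: loopT..|]; rewrite /T -f0 -f1.
  have [pb0 b00 b01] := betaP (f 0); have [pb1 b10 b11] := betaP (f 1).
  apply: homotopic_concat; [by rewrite path_concat0|exact: homotopic_refl|].
  apply: homotopic_concat => //; first by rewrite /rev_path subr0 b11.
  by apply: homotopic_refl; exact: is_path_rev.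
exists (P \o T) => // f lf; rewrite -PE /= /T.
have [pf f0 f1] := lf; rewrite f0 f1; have [pb b0 b1] := betaP x0.
have lb : is_loop x0 (beta x0) by split.
have lrb : is_loop x0 (rev_path (beta x0)).
  split; [exact: is_path_rev|by rewrite /rev_path subr0|].
  by rewrite /rev_path subrr.
(* On loops [T] is conjugation by the loop [beta x0], whose two contributions cancel because [K] is
   commutative. *)
rewrite PD ?PD//; last exact: is_loop_concat.
rewrite addrCA -[RHS]addr0; congr +%R; rewrite addrC -PD// -P0; apply: Ph.
- exact: is_loop_concat.
- by split=> //; exact: is_path_cst.
- by have := homotopic_rev pb; rewrite b1.
Qed.

End FundamentalGroup.
End AdditiveFunctional.

(** * Small loops with trivial image *)

Section CompactMetric.
Local Open Scope ring_scope.
Variables (R : realType) (X : metricType R).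
Notation I := (@unit_interval R).

Lemma mdist_lt (y x z : X) (a b : R) :
  mdist x y < a -> mdist y z < b -> mdist x z < a + b.
Proof. by move=> xy yz; apply: le_lt_trans (metric_triangle x y z) (ltrD xy
  yz). Qed.

Lemma inv_lt (e : R) : 0 < e -> exists N, forall n, (N <= n)%N ->
  n.+1%:R^-1 < e.
Proof.
move=> e0; exists (Num.bound e^-1) => n Nn.
rewrite invf_plt ?posrE//; apply: lt_le_trans (archi_boundP _) _.
  by rewrite invr_ge0 ltW.
by rewrite ler_nat ltnW.
Qed.

(** Heine-Cantor: pairs violating uniformity at all scales 1/(n+1) would cluster at a point where
    continuity fails. *)
Lemma compact_uniform (U : pseudoMetricType R) (A : set U) (f : U ->
  X) (e : R) :
  compact A -> {within A, continuous f} -> 0 < e ->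
  exists2 d : R, 0 < d & forall x y, A x -> A y -> ball x d y ->
    mdist (f x) (f y) < e.
Proof.
move=> cA /within_metricP cf e0; apply: contrapT => h.
have /choice[u uP] : forall n : nat, exists p : U * U,
    [/\ A p.1, A p.2, ball p.1 n.+1%:R^-1 p.2 & e <= mdist (f p.1) (f p.2)].
  move=> n; apply: contrapT => h'; apply: h; exists n.+1%:R^-1 => // x y Ax Ay
    xy.
  by rewrite ltNge; apply/negP => fxy; apply: h'; exists (x, y).
have [|x Ax cx] := @cluster_seq _ _ _ (fun n => (u n).1) cA.
  by move=> n; have [] := uP n.
have [d d0 dP] := cf x Ax _ (divr_gt0 e0 (ltr0Sn _ 1)).
have d20 : 0 < d / 2 by rewrite divr_gt0.
have [N NP] := inv_lt d20.
have [n Nn xn] := cx _ d20 N.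
have [A1 A2 b12] := uP n; rewrite leNgt => /negP; apply.
have h1 : mdist (f x) (f (u n).1) < e / 2.
  by apply: dP => //; apply: le_ball xn; lra.
have h2 : mdist (f x) (f (u n).2) < e / 2.
  apply: dP => //; rewrite [d]splitr; apply: ball_triangle xn _.
  by apply: le_ball b12; rewrite ltW// NP.
by rewrite [e]splitr; apply: mdist_lt h2; rewrite metric_sym.
Qed.

Hypothesis compactX : compact [set: X].

(** Without a finite net, greedy choice yields an infinite [e]-separated sequence, which cannot
    cluster. *)
Lemma finite_net (e : R) : 0 < e ->
  exists s : seq X, forall x, exists2 y, y \in s & mdist y x < e.
Proof.
move=> e0; apply: contrapT => h.
have /choice[g gP] : forall s : seq X, exists x, forall y, y \in s ->
    e <= mdist y x.
  move=> s; apply: contrapT => h'; apply: h; exists s => x.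
  apply: contrapT => nx; apply: h'; exists x => y ys; rewrite leNgt.
  by apply/negP => yx; apply: nx; exists y.
pose L n := iter n (fun s => g s :: s) [::].
have gL m n : (m < n)%N -> g (L m) \in L n.
  elim: n => // n IH; rewrite ltnS leq_eqVlt inE => /predU1P[->|/IH ->].
    by rewrite eqxx.
  by rewrite orbT.
have [|x _ cx] := @cluster_seq _ _ _ (fun n => g (L n)) compactX; first by [].
have e20 : 0 < e / 2 by rewrite divr_gt0.
have [m _] := cx _ e20 0%N; rewrite ballEmdist/= => xm.
have [n mn] := cx _ e20 m.+1; rewrite ballEmdist/= => xn.
have := gP _ _ (gL _ _ mn); apply/negP; rewrite -ltNge.
by rewrite [e]splitr; apply: mdist_lt xn; rewrite metric_sym.
Qed.

(** Bad pairs at distances tending to 0 would cluster, and both members of some pair would enter one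
    path connected neighbourhood of the cluster point. *)
Lemma uniformly_locally_path_connected (e : R) : 0 < e ->
  locally_path_connected R X ->
  exists2 d : R, 0 < d & forall x y : X, mdist x y < d ->
    exists f : R -> X, [/\ is_path f, f 0 = x, f 1 = y &
      forall t, I t -> mdist x (f t) < e].
Proof.
move=> e0 lpc; apply: contrapT => h.
have /choice[u uP] : forall n : nat, exists p : X * X,
    mdist p.1 p.2 < n.+1%:R^-1 /\ ~ exists f : R -> X,
    [/\ is_path f, f 0 = p.1, f 1 = p.2 & forall t, I t -> mdist p.1 (f t) < e].
  move=> n; apply: contrapT => h'; apply: h; exists n.+1%:R^-1 => // x y xy.
  by apply: contrapT => nf; apply: h'; exists (x, y).
have [|x _ cx] := @cluster_seq _ _ _ (fun n => (u n).1) compactX; first by [].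
have e20 : 0 < e / 2 by rewrite divr_gt0.
have [V [oV Vx Ve Vpc]] := lpc _ _ (nbhsx_ballx x _ e20).
have /nbhs_ballP[r /= r0 rV] := open_nbhs_nbhs (conj oV Vx).
have r20 : 0 < r / 2 by rewrite divr_gt0.
have [N NP] := inv_lt r20.
have [n Nn] := cx _ r20 N; rewrite ballEmdist/= => xn.
have [u12] := uP n; apply.
have V1 : V (u n).1 by apply: rV; rewrite ballEmdist/=; lra.
have V2 : V (u n).2.
  apply: rV; rewrite ballEmdist/= [r]splitr; apply: mdist_lt xn _.
  by apply: lt_trans u12 _; exact: NP.
have [f [pf f0 f1 fV]] := Vpc _ _ V1 V2; exists f; split=> // t It.
have := Ve _ (fV _ It); have := Ve _ V1; rewrite !ballEmdist/= => h1 h2.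
by rewrite [e]splitr; apply: mdist_lt h2; rewrite metric_sym.
Qed.

End CompactMetric.

(** * Reduction of loops to finitely many edges *)

Section SmallLoops.
Local Open Scope ring_scope.
Variables (R : realType) (X : metricType R) (K : zmodType).
Notation I := (@unit_interval R).
Implicit Types (f g h : R -> X) (F G : (R -> X) -> K).

Definition small_loops_vanish (d : R) := forall f (x : X), is_path f ->
  f 0 = f 1 -> (forall t, I t -> mdist x (f t) < d) ->
  forall F, path_additive F -> F f = 0.

Lemma path_concat_all (P : X -> Prop) f g :
  (forall t, I t -> P (f t)) -> (forall t, I t -> P (g t)) ->
  forall t, I t -> P (path_concat f g t).
Proof.
move=> Pf Pg t /andP[t0 t1]; rewrite /path_concat; case: leP => th.
  by apply: Pf; apply/andP; split; lra.
by apply: Pg; apply/andP; split; lra.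
Qed.

Lemma rev_path_all (P : X -> Prop) f :
  (forall t, I t -> P (f t)) -> forall t, I t -> P (rev_path f t).
Proof.
by move=> Pf t /andP[t0 t1]; apply: Pf; apply/andP; split; lra.
Qed.

(** Each short piece of [f], with paths [tau] from the net to its ends and an edge of [E], closes up
    inside a ball of radius [d]. If [G] kills the edges, its values on the pieces telescope to 0
    around [f]. *)
Lemma small_loops_determined (d : R) : compact [set: X] ->
  locally_path_connected R X -> 0 < d -> small_loops_vanish d ->
  exists s : seq X, exists E : X -> X -> R -> X,
    forall G, path_additive G ->
    (forall a b, a \in s -> b \in s -> G (E a b) = 0) ->
    forall f, is_path f -> f 0 = f 1 -> G f = 0.
Proof.
move=> cX lpc d0 small.
have e0 : 0 < d / 2 by rewrite divr_gt0.
have [r r0 rP] := uniformly_locally_path_connected cX e0 lpc.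
(* Net points of consecutive pieces are then less than 3r'/4 < r apart, so an edge of size d/2 joins
   them, and the closed paths stay within d/2 + 3r'/4 < d of [w x]. *)
pose r' := Num.min r (d / 2).
have r'0 : 0 < r' by rewrite lt_min r0.
have r'r : r' <= r by rewrite ge_min lexx.
have r'd : r' <= d / 2 by rewrite ge_min lexx orbT.
have r4 : 0 < r' / 4 by rewrite divr_gt0.
have [s sP] := finite_net cX r4.
have /choice[w wP] : forall x, exists y, y \in s /\ mdist y x < r' / 4.
  by move=> x; have [y ys yx] := sP x; exists y.
have /choice[E EP] : forall p : X * X, exists f : R -> X, mdist p.1 p.2 < r ->
    [/\ is_path f, f 0 = p.1, f 1 = p.2 &
        forall t, I t -> mdist p.1 (f t) < d / 2].
  move=> p; have [pr|npr] := boolP (mdist p.1 p.2 < r).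
    by have [f fP] := rP _ _ pr; exists f.
  by exists (fun=> p.1).
exists s, (fun a b => E (a, b)) => G addG GE f pf f01.
have [m m0 mP] := compact_uniform (@compact_unit_interval R) pf r4.
pose tau x := E (w x, x).
have tauP x : [/\ is_path (tau x), tau x 0 = w x, tau x 1 = x &
    forall t, I t -> mdist (w x) (tau x t) < d / 2].
  have [_ wx] := wP x; apply: (EP (w x, x)) => /=.
  by apply: lt_le_trans wx _; lra.
have step a b : I a -> I b -> `|a - b| < m ->
    G (segment f a b) = G (tau (f b)) - G (tau (f a)).
  move=> Ia Ib ab; set x := f a; set y := f b.
  have [pt t0 t1 td] := tauP x; have [pt' t0' t1' td'] := tauP y.
  have pseg : is_path (segment f a b) by exact: is_path_segment.
  have s0 : segment f a b 0 = x by rewrite /segment mulr0 addr0.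
  have s1 : segment f a b 1 = y by rewrite /segment mulr1 addrC subrK.
  have [wxs wx] := wP x; have [wys wy] := wP y.
  have xy : mdist x y < r' / 4 by apply: mP.
  have wxy : mdist (w x) (w y) < r' / 4 + r' / 4 + r' / 4.
    by apply: mdist_lt (mdist_lt wx xy) _; rewrite metric_sym.
  have [|/= pE E0 E1 Ed] := EP (w x, w y); first by apply: lt_le_trans wxy _;
    lra.
  have pEt : is_path (path_concat (E (w x, w y)) (tau y)).
    by apply: is_path_concat; rewrite // E1.
  (* The closed path: [tau x], then the segment, then back along [tau y] and the edge from [w x] to
     [w y]. *)
  have := small (path_concat (path_concat (tau x) (segment f a b))
    (rev_path (path_concat (E (w x, w y)) (tau y)))) (w x) _ _ _ G addG.
  rewrite additive_closed//; last first.
  - by rewrite path_concat1 s1 t1'.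
  - by rewrite path_concat0 E0.
  - by rewrite t1 s0.
  rewrite addG.1//; last by rewrite E1.
  rewrite (GE (w x) (w y))// add0r => h.
  apply/eqP; rewrite -subr_eq0 opprB addrC addrAC h//.
  - apply: is_path_concat; [|exact: is_path_rev|].
      by apply: is_path_concat => //; rewrite t1 s0.
    by rewrite path_concat1 /rev_path subr0 path_concat1 s1 t1'.
  - by rewrite path_concat0 path_concat0 t0 path_concat1 /rev_path subrr
      path_concat0.
  - pose P z := mdist (w x) z < d; apply: (@path_concat_all P);
    first apply: (@path_concat_all P).
    + by move=> t It; apply: lt_trans (td _ It) _; lra.
    + move=> t It; apply: (@lt_trans _ _ (r' / 4 + r' / 4)); last lra.
      apply: mdist_lt wx _; apply: mP => //; first exact: unit_convex.
      rewrite /ball/= opprD addNKr normrN normrM.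
      move: It => /andP[t0'' t1'']; rewrite (ger0_norm t0'').
      by apply: le_lt_trans ab; rewrite distrC ler_piMr.
    + apply: (@rev_path_all P); apply: (@path_concat_all P) => t It.
        by apply: lt_trans (Ed _ It) _; lra.
      apply: lt_le_trans (mdist_lt wxy (td' _ It)) _; lra.
have [N /(_ N (leqnn _)) NP] := inv_lt m0.
pose q j : R := j%:R / N.+1%:R.
have q_unit j : (j <= N.+1)%N -> I (q j).
  move=> jN; apply/andP; split; first by rewrite divr_ge0.
  by rewrite ler_pdivrMr ?mul1r ?ler_nat.
have ind j : (j <= N.+1)%N ->
    G (segment f 0 (q j)) = G (tau (f (q j))) - G (tau (f 0)).
  elim: j => [|j IH] jN.
    rewrite /q mul0r subrr -(additive_cst addG (f 0)); congr G.
    by apply/funext => t; rewrite /segment subrr mul0r addr0.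
  have Ij := q_unit _ (ltnW jN); have Ij1 := q_unit _ jN.
  rewrite (additive_segment addG (@unit0 R) Ij Ij1)// IH ?(ltnW jN)//.
  rewrite step//; first by rewrite addrC addrA subrK.
  rewrite distrC /q -mulrBl -natrB// subSnn mul1r ger0_norm//.
have := ind _ (leqnn _); rewrite /q divff ?pnatr_eq0// f01 subrr => <-.
apply: additive_eq => //.
  by apply: is_path_segment => //; [exact: unit0|exact: unit1].
by move=> t _; rewrite /segment add0r subr0 mul1r.
Qed.

(** A homomorphism is coded by the values of its functional on the finitely many edges; injectivity
    comes from [small_loops_determined] applied to a difference. *)
Lemma hom_small (d : R) (x0 : X) : peano_continuum X -> 0 < d ->
  small_loops_vanish d ->
  exists n, exists phi : (pi1 R x0 -> K) -> {ffun 'I_n * 'I_n -> K},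
    {in @pi1_hom R X x0 K &, injective phi}.
Proof.
move=> [cX pcX lpc] d0 small.
have [s [E EP]] := small_loops_determined cX lpc d0 small.
have /choice[beta betaP] : forall x, exists f : R -> X,
    [/\ is_path f, f 0 = x0 & f 1 = x].
  by move=> x; have [//|//|f [pf f0 f1 _]] := pcX x0 x; exists f.
have /choice[F FP] : forall psi : pi1 R x0 -> K, exists F, pi1_hom psi ->
    path_additive F /\ forall f (h : is_loop x0 f), F f = psi (pi1_of h).
  move=> psi; have [hpsi|] := pselect (pi1_hom psi); last by exists (fun=> 0).
  by have [F aF FE] := additive_of_hom betaP hpsi; exists F.
exists (size s), (fun psi => [ffun ij => F psi (E (tnth (in_tuple s) ij.1)
  (tnth (in_tuple s) ij.2))]) => psi psi'; rewrite !inE => /FP[aF FE] /FP[aF'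
    FE'].
move=> /ffunP e; apply/funext => a; have [f [h ->]] := pi1_ofP a.
rewrite -FE -FE'; apply/eqP; rewrite -subr_eq0; apply/eqP.
have [pf f0 f1] := h.
apply: (EP _ (path_additiveB aF aF')) => //; last by rewrite f0 f1.
move=> x y /(tnthP (in_tuple s))[i ->] /(tnthP (in_tuple s))[j ->].
by have := e (i, j); rewrite !ffunE /= => ->; rewrite subrr.
Qed.

End SmallLoops.

(** * Countable covers and infinite concatenations *)

Section MapsFromSquare.
Local Open Scope ring_scope.
Variables (R : realType) (X : metricType R) (x0 : X).
Hypothesis compactX : compact [set: X].
Notation I := (@unit_interval R).
Notation sq := (@unit_square R).

(** Separability of the space of continuous maps on the square, at scale [e]: an index records a
    grid size and, for each cell, a net point close to the values there. *)
Lemma countable_cover_square (e : R) : 0 < e ->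
  exists Cov : nat -> set (R * R -> X),
    (forall H, {within sq, continuous H} -> exists n, Cov n H) /\
    (forall n H H' p, sq p -> Cov n H -> Cov n H' -> mdist (H p) (H' p) < e).
Proof.
move=> e0; have e4 : 0 < e / 4 by rewrite divr_gt0.
have [s sP] := finite_net compactX e4.
(* The number of a cell encodes its lower left corner; a coordinate equal to 1 has index [m.+1],
   whence the base [m.+2]. *)
pose cell m (p : R * R) :=
  (Num.truncn (m.+1%:R * p.1) * m.+2 + Num.truncn (m.+1%:R * p.2))%N.
pose rep m c : R * R := ((c %/ m.+2)%:R / m.+1%:R, (c %% m.+2)%:R / m.+1%:R).
pose Cov (k : nat * seq nat) : set (R * R -> X) := [set H | forall p, sq p ->
  mdist (nth x0 s (nth 0%N k.2 (cell k.1 p))) (H p) < e / 2].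
exists (fun n => if unpickle n is Some k then Cov k else set0); split;
  last first.
  move=> n H H' p Ip; case: unpickle => // k HC HC'.
  by rewrite [e]splitr; apply: mdist_lt (HC' _ Ip); rewrite metric_sym;
    exact: HC.
move=> H cH; have [d d0 dP] := compact_uniform (@compact_unit_square R) cH e4.
have [m /(_ m (leqnn m)) md] := inv_lt d0.
(* Each cell gets the first net point within e/4 of the value at its corner; uniform continuity
   costs another e/4 across the cell. *)
pose tab := mkseq (fun c => find (fun y => mdist y (H (rep m c)) < e / 4) s)
  (m.+2 * m.+2).
exists (pickle (m, tab)); rewrite pickleK => p /[dup] Ip [/andP[p10 p11]
  /andP[p20 p21]] /=.
have trunc (x : R) : 0 <= x -> x <= 1 ->
    let i := Num.truncn (m.+1%:R * x) in
    [/\ (i < m.+2)%N, I (i%:R / m.+1%:R) & `|i%:R / m.+1%:R - x| < d].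
  move=> x_ge0 x_le1 i.
  have /truncn_itv/andP[il iu] : 0 <= m.+1%:R * x by rewrite mulr_ge0.
  have im : (i <= m.+1)%N.
    rewrite -(ler_nat R); apply: le_trans il _; exact: ler_piMr.
  have ix : i%:R / m.+1%:R <= x by rewrite ler_pdivrMr// mulrC.
  split=> //.
    apply/andP; split; first by rewrite divr_ge0.
    by rewrite ler_pdivrMr// mul1r ler_nat.
  rewrite distrC ger0_norm ?subr_ge0//; apply: lt_le_trans (ltW md).
  rewrite ltrBlDl -[X in _ + X]mul1r -mulrDl ltr_pdivlMr//.
  by rewrite natr1 mulrC.
have [i1 I1 d1] := trunc _ p10 p11; have [i2 I2 d2] := trunc _ p20 p21.
set i := Num.truncn _ in i1 I1 d1; set j := Num.truncn _ in i2 I2 d2.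
have repE : rep m (cell m p) = (i%:R / m.+1%:R, j%:R / m.+1%:R).
  by rewrite /rep /cell -/i -/j divnMDl// modnMDl divn_small// addn0 modn_small.
have lt : (cell m p < m.+2 * m.+2)%N.
  rewrite /cell -/i -/j; apply: (@leq_trans (i * m.+2 + m.+2)).
    by rewrite ltn_add2l.
  by rewrite -mulSnr leq_mul2r i1 orbT.
rewrite nth_mkseq//; move: repE; set c := cell m p => repE.
have hs : has (fun y => mdist y (H (rep m c)) < e / 4) s.
  by have [y ys yH] := sP (H (rep m c)); apply/hasP; exists y.
rewrite (_ : e / 2 = e / 4 + e / 4); last by field.
apply: mdist_lt; first exact: nth_find hs.
apply: dP => //; first by rewrite repE.
by rewrite repE.
Qed.

(** Compactness supplies pointwise cluster points, and the uniform Cauchy condition turns them into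
    a uniform limit. *)
Lemma uniform_limit (U : pseudoMetricType R) (A : set U) (h : nat -> U -> X) :
  (forall k, {within A, continuous (h k)}) ->
  (forall e : R, 0 < e -> exists N, forall k l p, (N <= k)%N -> (N <= l)%N ->
     A p -> mdist (h k p) (h l p) < e) ->
  exists2 H : U -> X, {within A, continuous H} &
    forall p, A p -> forall e : R, 0 < e -> exists N, forall k, (N <= k)%N ->
      mdist (h k p) (H p) < e.
Proof.
move=> ch cauchy.
have /choice[H HP] : forall p, exists x : X, forall e : R, 0 < e ->
    forall N, exists2 n, (N <= n)%N & ball x e (h n p).
  move=> p; have [|x _ xP] := @cluster_seq _ _ _ (fun n => h n p) compactX.
    by [].
  by exists x.
have hH (e : R) : 0 < e -> exists N, forall k p, (N <= k)%N -> A p ->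
    mdist (h k p) (H p) < e.
  move=> e0; have e20 : 0 < e / 2 by rewrite divr_gt0.
  have [N NP] := cauchy _ e20; exists N => k p Nk Ap.
  have [n Nn] := HP p _ e20 N; rewrite ballEmdist/= => Hn.
  by rewrite [e]splitr; apply: mdist_lt (NP _ _ _ Nk Nn Ap) _;
    rewrite metric_sym.
exists H; last first.
  by move=> p Ap e /hH[N NP]; exists N => k Nk; exact: NP.
apply/within_metricP => p Ap e e0; have e30 : 0 < e / 3 by rewrite divr_gt0.
have [N NP] := hH _ e30.
have [d d0 dP] := (within_metricP _ _).1 (ch N) _ Ap _ e30.
exists d => // q Aq pq; rewrite (_ : e = e / 3 + e / 3 + e / 3); last by field.
apply: mdist_lt (NP _ _ (leqnn N) Aq); apply: mdist_lt (dP _ Aq pq).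
by rewrite metric_sym; exact: NP.
Qed.

Lemma limit_eq (u v : nat -> X) (x y : X) :
  (forall e : R, 0 < e -> exists N, forall k, (N <= k)%N ->
    mdist (u k) x < e) ->
  (forall e : R, 0 < e -> exists N, forall k, (N <= k)%N ->
    mdist (v k) y < e) ->
  (forall e : R, 0 < e -> exists N, forall k, (N <= k)%N ->
     mdist (u k) (v k) < e) -> x = y.
Proof.
move=> ux vy uv; apply: mdist_positivity; apply/eqP;
  rewrite eq_le mdist_ge0 andbT.
apply/ler_addgt0Pl => e e0; rewrite addr0.
have e30 : 0 < e / 3 by rewrite divr_gt0.
have [N1 P1] := ux _ e30; have [N2 P2] := vy _ e30; have [N3 P3] := uv _ e30.
pose k := maxn N1 (maxn N2 N3).
rewrite (_ : e = e / 3 + e / 3 + e / 3); last by field.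
apply/ltW/(mdist_lt _ (P2 k _)); last by rewrite !leq_max leqnn orbT.
apply: mdist_lt (P3 k _); last by rewrite !leq_max leqnn !orbT.
by rewrite metric_sym; apply: P1; rewrite leq_maxl.
Qed.

End MapsFromSquare.

(** * Infinite concatenations of shrinking loops *)

Section InfiniteConcatenation.
Local Open Scope ring_scope.
Variables (R : realType) (X : metricType R) (x0 : X) (gam : nat -> R -> X).
Hypothesis compactX : compact [set: X].
Notation I := (@unit_interval R).
Hypothesis gamP : forall n, is_loop x0 (gam n).
Hypothesis gam_small : forall n t, I t -> mdist x0 (gam n t) < n.+1%:R^-1.
Implicit Types a b : nat -> bool.

(** A skipped index keeps its time slot as a constant path, so sequences agreeing below [k] give
    paths agreeing on the first [k] slots. *)
Let piece n a : R -> X := if a n then gam n else fun=> x0.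

Fixpoint partial_concat k n a : R -> X :=
  if k is k'.+1 then path_concat (piece n a) (partial_concat k' n.+1 a)
  else fun=> x0.

Let pieceP n a : is_loop x0 (piece n a).
Proof.
rewrite /piece; case: (a n); first exact: gamP.
by split=> //; exact: is_path_cst.
Qed.

Let piece_small n a t : I t -> mdist x0 (piece n a t) < n.+1%:R^-1.
Proof.
move=> It; rewrite /piece; case: (a n); first exact: gam_small.
by rewrite mdistxx invr_gt0.
Qed.

Lemma partial_concatP k n a : is_loop x0 (partial_concat k n a).
Proof.
elim: k n => [n|k IH n]; first by split=> //; exact: is_path_cst.
exact: is_loop_concat.
Qed.

Lemma partial_concat_small k n a t : I t ->
  mdist x0 (partial_concat k n a t) < n.+1%:R^-1.
Proof.
elim: k n t => [n t _|k IH n /=]; first by rewrite mdistxx invr_gt0.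
apply: (@path_concat_all _ _ (fun z => mdist x0 z < n.+1%:R^-1)) => t It.
  exact: piece_small.
by apply: lt_le_trans (IH _ _ It) _; rewrite lef_pV2 ?posrE// ler_nat.
Qed.

(** Past the first [k] slots the shorter path rests at [x0], and the longer one stays in the ball of
    radius 1/(n+k+1). *)
Lemma partial_concat_cauchy k l n a t : (k <= l)%N -> I t ->
  mdist (partial_concat k n a t) (partial_concat l n a t) < (n + k).+1%:R^-1.
Proof.
elim: k l n t => [l n t _ It|k IH [//|l] n t kl /andP[t0 t1] /=].
  by rewrite addn0; exact: partial_concat_small.
rewrite /path_concat; case: (leP t 2^-1) => th;
  first by rewrite mdistxx invr_gt0.
by rewrite addnS -addSn; apply: IH => //; apply/andP; split; lra.
Qed.

Lemma eq_partial_concat k n a b :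
  (forall i, (n <= i)%N -> (i < n + k)%N -> a i = b i) ->
  partial_concat k n a = partial_concat k n b.
Proof.
elim: k n => // k IH n ab /=; rewrite /piece (ab n) ?leqnn//; last first.
  by rewrite addnS ltnS leq_addr.
rewrite (IH n.+1)// => i ni ik; apply: ab; first exact: ltnW.
by rewrite addnS -addSn.
Qed.

Lemma infinite_concat_ex n a : exists2 g : R -> X, is_path g &
  forall t, I t -> forall e : R, 0 < e -> exists N, forall k, (N <= k)%N ->
    mdist (partial_concat k n a t) (g t) < e.
Proof.
apply: (uniform_limit compactX); first by move=> k; have [] :=
  partial_concatP k n a.
move=> e e0; have [N NP] := inv_lt e0; exists N => k l t Nk Nl It.
have small m : (N <= m)%N -> (n + m).+1%:R^-1 < e.
  by move=> Nm; apply: NP; rewrite (leq_trans Nm)// leq_addl.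
have [kl|/ltnW lk] := leqP k l.
  exact: lt_trans (partial_concat_cauchy _ _ kl It) (small _ Nk).
by rewrite metric_sym; exact: lt_trans (partial_concat_cauchy _ _ lk It)
  (small _ Nl).
Qed.

Definition infinite_concat n a : R -> X :=
  projT1 (cid2 (infinite_concat_ex n a)).

Lemma infinite_concat_path n a : is_path (infinite_concat n a).
Proof. by rewrite /infinite_concat; case: cid2. Qed.

Lemma infinite_concat_lim n a t : I t -> forall e : R, 0 < e ->
  exists N, forall k, (N <= k)%N ->
    mdist (partial_concat k n a t) (infinite_concat n a t) < e.
Proof. by rewrite /infinite_concat; case: cid2 => g pg gP; exact: gP. Qed.

Lemma infinite_concat_near k n a t : I t ->
  mdist (partial_concat k n a t) (infinite_concat n a t) <= (n + k).+1%:R^-1.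
Proof.
move=> It; apply/ler_addgt0Pl => e e0.
have [N NP] := infinite_concat_lim n a It e0.
apply/ltW; rewrite addrC; apply: mdist_lt (NP (maxn k N) _).
  by apply: partial_concat_cauchy => //; rewrite leq_maxl.
by rewrite leq_maxr.
Qed.

Lemma infinite_concat_loop n a : is_loop x0 (infinite_concat n a).
Proof.
split; first exact: infinite_concat_path.
  apply: (limit_eq (infinite_concat_lim n a (@unit0 R)) (v :=
    fun=> x0)) => e e0;
    exists 0%N => k _; rewrite ?mdistxx//.
  by have [_ -> _] := partial_concatP k n a; rewrite mdistxx.
apply: (limit_eq (infinite_concat_lim n a (@unit1 R)) (v := fun=> x0)) => e e0;
  exists 0%N => k _; rewrite ?mdistxx//.
by have [_ _ ->] := partial_concatP k n a; rewrite mdistxx.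
Qed.

Lemma infinite_concatS n a t : I t -> infinite_concat n a t =
  path_concat (piece n a) (infinite_concat n.+1 a) t.
Proof.
move=> It; apply: (limit_eq (u := fun k => partial_concat k.+1 n a t)
  (v := fun k => partial_concat k.+1 n a t)) => e e0; last first.
- by exists 0%N => k _; rewrite mdistxx.
- have {It} /andP[t0 t1] := It; rewrite /= /path_concat; case: leP => th.
    by exists 0%N => k _; rewrite mdistxx.
  by apply: infinite_concat_lim => //; apply/andP; split; lra.
- have [N NP] := infinite_concat_lim n a It e0; exists N => k Nk.
  by apply: NP; exact: leqW.
Qed.

Lemma infinite_concat_tail n a b : (forall i, (n <= i)%N -> a i = b i) ->
  forall t, I t -> infinite_concat n a t = infinite_concat n b t.
Proof.
move=> ab t It; apply: (limit_eq (infinite_concat_lim n a It)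
  (infinite_concat_lim n b It)) => e e0; exists 0%N => k _.
by rewrite (@eq_partial_concat _ _ _ b) ?mdistxx// => i ni _; exact: ab.
Qed.

(** Both loops are within 1/(k+1) of the same partial concatenation. *)
Lemma infinite_concat_modulus k a b t :
  (forall i, (i < k)%N -> a i = b i) -> I t ->
  mdist (infinite_concat 0 a t) (infinite_concat 0 b t) <= 2 / k.+1%:R.
Proof.
move=> ab It; have := infinite_concat_near k 0 a It.
have := infinite_concat_near k 0 b It.
rewrite add0n (@eq_partial_concat k 0 a b); last by move=> i _; exact: ab.
rewrite mulr2n mulrDl mul1r => hb ha.
apply: le_trans (metric_triangle _ (partial_concat k 0 b t) _) _.
by apply: lerD => //; rewrite metric_sym.
Qed.

Section Additive.
Variables (K : zmodType) (F : (R -> X) -> K).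
Hypothesis addF : path_additive F.

Lemma additive_infinite_concatS n a : F (infinite_concat n a) =
  (if a n then F (gam n) else 0) + F (infinite_concat n.+1 a).
Proof.
have [pp p0 p1] := pieceP n a; have [pc c0 c1] := infinite_concat_loop n.+1 a.
rewrite (additive_eq addF _ _ (@infinite_concatS n a)); last first.
- by apply: is_path_concat => //; rewrite p1 c0.
- exact: infinite_concat_path.
rewrite addF.1//; last by rewrite p1 c0.
by rewrite /piece; case: (a n); rewrite ?additive_cst.
Qed.

(** Only finite additivity enters: once the pieces up to [N] are split off, the two tails
    coincide. *)
Lemma additive_infinite_concat_update a N : F (infinite_concat 0 (update a N
  true))
  = F (infinite_concat 0 (update a N false)) + F (gam N).
Proof.
suff h d n : (n + d = N)%N -> F (infinite_concat n (update a N true)) =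
    F (infinite_concat n (update a N false)) + F (gam N) by exact: (h N).
elim: d n => [n|d IH n nd].
  rewrite addn0 => ->; rewrite (additive_infinite_concatS N (update a N true)).
  rewrite (additive_infinite_concatS N (update a N false)) {1 3}/update eqxx
    add0r.
  rewrite addrC; congr (_ + _); apply: additive_eq => //;
    try exact: infinite_concat_path.
  by apply: infinite_concat_tail => i; rewrite /update; case: eqVneq => // ->;
    rewrite ltnn.
rewrite (additive_infinite_concatS n (update a N true)).
rewrite (additive_infinite_concatS n (update a N false)) IH ?addrA;
  last by rewrite addSnnS.
by rewrite {1 3}/update ltn_eqF// -nd addnS ltnS leq_addr.
Qed.

End Additive.
End InfiniteConcatenation.

(** * Linear relations between paths *)

Section Relators.
Local Open Scope ring_scope.
Variables (R : realType) (X : metricType R) (x0 : X) (K : fieldType).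
Notation I := (@unit_interval R).
Notation sq := (@unit_square R).
Implicit Types (f g : R -> X) (h : R * R -> X) (T : seq (K * (R -> X))).
Implicit Types (F : (R -> X) -> K) (lab : seq nat).

Definition is_homotopy h := {within sq, continuous h} /\
  forall s, I s -> h (0, s) = h (0, 0) /\ h (1, s) = h (1, 0).

(** A multiple [q] of a concatenation relation between the bottom sides of [h1] and [h2] when [b]
    holds, and otherwise of the relation between bottom and top of [h1]. With all data being maps of
    the square, one limit argument serves both kinds. *)
Definition relator := (K * (R * R -> X) * (R * R -> X) * bool)%type.

Definition valid_relator (r : relator) := let: (_, h1, h2, b) := r in
  [/\ is_homotopy h1, is_homotopy h2 & b -> h1 (1, 0) = h2 (0, 0)].

Definition relator_terms (r : relator) : seq (K * (R -> X)) :=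
  let: (q, h1, h2, b) := r in
  if b then [:: (q, path_concat (fun t => h1 (t, 0)) (fun t => h2 (t, 0)));
                (- q, fun t => h1 (t, 0)); (- q, fun t => h2 (t, 0))]
  else [:: (q, fun t => h1 (t, 0)); (- q, fun t => h1 (t, 1))].

Definition eval F T := \sum_(p <- T) p.1 * F p.2.

Let dflt : K * (R -> X) := (0, fun=> x0).

(* The labels record which paths of [T] coincide on [0,1].  For fixed labels,
   unlike the vanishing of a formal sum, being balanced passes to limits. *)
Definition balanced lab T :=
  (forall u v, (u < size T)%N -> (v < size T)%N ->
     nth 0%N lab u = nth 0%N lab v ->
     forall t, I t -> (nth dflt T u).2 t = (nth dflt T v).2 t) /\
  forall l : nat, \sum_(u < size T | nth 0%N lab u == l) (nth dflt T u).1 = 0.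

Definition all_paths T := forall p, p \in T -> is_path p.2.

Lemma homotopy_bottom h : is_homotopy h -> is_path (fun t => h (t, 0)).
Proof.
move=> [ch _]; apply: (@within_comp _ _ _ _ _ (fun t : R => (t, 0 : R))) ch.
  by move=> t; apply: continuous_pair; [exact: cvg_id|exact: cvg_cst].
by move=> t It; split=> //=; exact: unit0.
Qed.

Lemma homotopy_top h : is_homotopy h -> is_path (fun t => h (t, 1)).
Proof.
move=> [ch _]; apply: (@within_comp _ _ _ _ _ (fun t : R => (t, 1 : R))) ch.
  by move=> t; apply: continuous_pair; [exact: cvg_id|exact: cvg_cst].
by move=> t It; split=> //=; exact: unit1.
Qed.

Lemma relator_paths r : valid_relator r -> all_paths (relator_terms r).
Proof.
case: r => [[[q h1] h2] b] [H1 H2 H12] p.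
have p1 := homotopy_bottom H1; have p2 := homotopy_bottom H2.
have p3 := homotopy_top H1.
rewrite /relator_terms; case: b H12 => H12; rewrite !inE.
  case/or3P => /eqP -> //=; apply: is_path_concat => //; exact: H12.
by case/orP => /eqP ->.
Qed.

Lemma eval_cat F T T' : eval F (T ++ T') = eval F T + eval F T'.
Proof. exact: big_cat. Qed.

Lemma eval_relator F r : path_additive F -> valid_relator r ->
  eval F (relator_terms r) = 0.
Proof.
move=> addF; case: r => [[[q h1] h2] b] [H1 H2 H12].
have p1 := homotopy_bottom H1; have p2 := homotopy_bottom H2.
have p3 := homotopy_top H1; rewrite /eval /relator_terms.
case: b H12 => H12; rewrite !big_cons big_nil /= addr0.
  by rewrite addF.1 ?H12//; ring.
rewrite (addF.2 _ (fun t => h1 (t, 1))) ?mulNr ?subrr//.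
by case: H1 => c1 h1e; exists h1; split.
Qed.

Lemma eval_balanced F lab T : path_additive F -> all_paths T ->
  balanced lab T -> eval F T = 0.
Proof.
move=> addF pT [eqT sumT].
have pathT u : (u < size T)%N -> is_path (nth dflt T u).2.
  by move=> uT; apply: pT; exact: mem_nth.
(* [G l] is the common value of [F] on the paths labelled [l]. *)
have /choice[G GP] : forall l : nat, exists x, forall u, (u < size T)%N ->
    nth 0%N lab u = l -> F (nth dflt T u).2 = x.
  move=> l; have [[u [uT ul]]|nu] := pselect (exists u, (u < size T)%N /\
      nth 0%N lab u = l); last by exists 0 => u uT ul; case: nu; exists u.
  exists (F (nth dflt T u).2) => v vT vl; apply: (additive_eq addF).
  - exact: pathT.
  - exact: pathT.
  - by apply: eqT => //; rewrite vl.
pose l := [seq ((nth dflt T u).1, nth 0%N lab u) | u <- index_iota 0 (size T)].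
transitivity (\sum_(p <- l) p.1 *: (G p.2 : K^o)).
  rewrite /eval (big_nth dflt) big_map big_seq [RHS]big_seq.
  by apply: eq_bigr => u; rewrite mem_index_iota => /andP[_ uT];
    rewrite (GP _ u uT erefl).
rewrite sum_regroup big1// => i _; rewrite (_ : \sum_(p <- l | _) _ = 0).
  by rewrite scale0r.
by rewrite big_map big_mkord /= sumT.
Qed.

(** A finite certificate that [T] vanishes modulo the relations: together with the relators of [L],
    its terms cancel. *)
Definition derivable T := exists (L : seq relator) lab,
  (forall r, r \in L -> valid_relator r) /\
  balanced lab (flatten [seq relator_terms r | r <- L] ++ T).

Lemma eval_derivable F T : path_additive F -> all_paths T -> derivable T ->
  eval F T = 0.
Proof.
move=> addF pT [L [lab [vL /(eval_balanced addF)]]].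
suff [pL eL] : all_paths (flatten [seq relator_terms r | r <- L]) /\
    eval F (flatten [seq relator_terms r | r <- L]) = 0.
  rewrite eval_cat eL add0r; apply => p; rewrite mem_cat.
  by move=> /orP[/pL|/pT].
split.
  by move=> p /flatten_mapP[r rL]; apply: relator_paths; exact: vL.
elim: L vL => [_|r L IH vL /=]; first by rewrite /eval big_nil.
rewrite eval_cat (eval_relator addF (vL _ (mem_head _ _))) add0r IH// => r' r'L.
by apply: vL; rewrite in_cons r'L orbT.
Qed.

(* The free vector space on paths is realised inside [K^(R -> X)]. *)
Definition delta f : (R -> X) -> K^o := fun g => (g == f)%:R.

Definition formal T : (R -> X) -> K^o := \sum_(p <- T) p.1 *: delta p.2.

Lemma formalE T g : formal T g = \sum_(p <- T) p.1 * (g == p.2)%:R.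
Proof. by rewrite /formal fct_sumE. Qed.

Definition relation_space : set ((R -> X) -> K^o) := [set v |
  exists2 L : seq relator, (forall r, r \in L -> valid_relator r) &
    v = formal (flatten [seq relator_terms r | r <- L])].

Lemma relation_space0 : relation_space 0.
Proof. by exists [::] => //; rewrite /formal big_nil. Qed.

Lemma formal_cat T T' : formal (T ++ T') = formal T + formal T'.
Proof. exact: big_cat. Qed.

Lemma relation_space_linear a v w : relation_space v -> relation_space w ->
  relation_space (a *: v + w).
Proof.
move=> [L vL ->] [L' vL' ->].
exists ([seq (a * r.1.1.1, r.1.1.2, r.1.2, r.2) | r <- L] ++ L').
  move=> r; rewrite mem_cat => /orP[/mapP[[[[q h1] h2] b] /vL ? ->]|/vL'] //.
rewrite map_cat flatten_cat formal_cat; congr (_ + _).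
elim: L {vL} => [|[[[q h1] h2] b] L IH] /=.
  by rewrite /formal !big_nil scaler0.
rewrite !formal_cat scalerDr IH; congr (_ + _).
by rewrite /formal scaler_sumr; case: b; rewrite !big_cons !big_nil /=
  !scalerA ?mulrN.
Qed.

(** A path is labelled by its first position in the list, so the sum over a label is the value of
    [formal T] at that path. *)
Lemma formal_balanced T : formal T = 0 -> exists lab, balanced lab T.
Proof.
move=> T0; pose S := [seq p.2 | p <- T].
have Sn u : (u < size T)%N -> nth (fun=> x0) S u = (nth dflt T u).2.
  by move=> uT; rewrite (nth_map dflt).
exists [seq index f S | f <- S].
have labE u : (u < size T)%N -> nth 0%N [seq index f S | f <- S] u =
    index (nth dflt T u).2 S.
  by move=> uT; rewrite (nth_map (fun=> x0)) ?size_map// Sn.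
have mS u : (u < size T)%N -> (nth dflt T u).2 \in S.
  by move=> uT; apply: map_f; exact: mem_nth.
split=> [u v uT vT|l].
  rewrite !labE// => /(congr1 (nth (fun=> x0) S)).
  by rewrite !nth_index ?mS// => -> t.
have [[u0 u0l]|nu] := pselect (exists u0 : 'I_(size T),
    nth 0%N [seq index f S | f <- S] u0 = l); last first.
  by rewrite big1// => u /eqP ul; case: nu; exists u.
have := congr1 (fun F => F (nth dflt T u0).2) T0; rewrite formalE.
rewrite (big_nth dflt) big_mkord => e.
rewrite big_mkcond/=; apply: etrans e.
apply: eq_bigr => u _; rewrite -u0l !labE//.
case: eqVneq => [/(congr1 (nth (fun=> x0) S))|ne].
  by rewrite !nth_index ?mS// => ->; rewrite eqxx mulr1.
case: eqVneq => [e|_]; last by rewrite mulr0.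
by rewrite e eqxx in ne.
Qed.

Lemma linear_formal (L : ((R -> X) -> K^o) -> K) :
  (forall a x y, L (a *: x + y) = a * L x + L y) -> L 0 = 0 ->
  forall T, L (formal T) = eval (L \o delta) T.
Proof.
move=> Llin L0; elim=> [|p T IH]; first by rewrite /formal /eval !big_nil.
by rewrite /formal /eval !big_cons Llin -/(formal T) IH.
Qed.

Lemma linear_additive (L : ((R -> X) -> K^o) -> K) :
  (forall a x y, L (a *: x + y) = a * L x + L y) ->
  (forall w, relation_space w -> L w = 0) -> path_additive (L \o delta).
Proof.
move=> Llin LW; have L0 : L 0 = 0 by apply: LW; exact: relation_space0.
have Lr r : valid_relator r -> eval (L \o delta) (relator_terms r) = 0.
  move=> vr; rewrite -linear_formal//; apply: LW; exists [:: r].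
    by move=> r'; rewrite inE => /eqP ->.
  by rewrite /= cats0.
have cst_homotopy f : is_path f -> is_homotopy (f \o fst).
  move=> pf; split=> //; apply: within_comp pf => [p|p []//].
  exact: cvg_fst.
split=> [f g pf pg fg|f g pf pg [H [cH Hf Hg He]]].
  have := Lr (1, f \o fst, g \o fst, true) (And3 (cst_homotopy _ pf)
    (cst_homotopy _ pg) (fun=> fg)).
  rewrite /eval !big_cons big_nil addr0 /= mul1r !mulN1r -opprD.
  by move/subr0_eq.
(* [delta] sees the values of a path off [0,1], so the two ends of the homotopy
   have to be exactly [f] and [g]. *)
pose H' : R * R -> X := fun p => if p.2 == 0 then f p.1 else
  if p.2 == 1 then g p.1 else H p.
have hH' : is_homotopy H'.
  split.
    apply: within_eq cH => -[t s] [/= It Is]; rewrite /H' /=.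
    case: eqVneq => [->|_]; first exact: Hf.
    by case: eqVneq => [->|_] //; exact: Hg.
  move=> s Is; rewrite /H'/= eqxx; have [h0 h1] := He _ Is.
  have [g0 g1] : f 0 = g 0 /\ f 1 = g 1.
    by apply: homotopic_ends; exists H.
  by rewrite -g0 -g1 h0 h1; case: eqP => // _; case: eqP.
have e0 : (fun t : R => H' (t, 0 : R)) = f.
  by apply/funext => t; rewrite /H'/= eqxx.
have e1 : (fun t : R => H' (t, 1 : R)) = g.
  by apply/funext => t; rewrite /H'/= oner_eq0 eqxx.
have := Lr (1, H', H', false) (And3 hH' hH' (fun ff => False_ind _ (notF ff))).
rewrite /relator_terms e0 e1 /eval !big_cons big_nil addr0 mul1r mulN1r.
exact: subr0_eq.
Qed.

Lemma derivable_of_relation T : relation_space (formal T) -> derivable T.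
Proof.
move=> TW; have [L vL LT] : relation_space (- formal T).
  by rewrite -scaleN1r -[X in _ X]addr0; apply: relation_space_linear => //;
    exact: relation_space0.
have [|lab labP] := @formal_balanced (flatten [seq relator_terms r | r <- L]
  ++ T).
  by rewrite formal_cat -LT addNr.
by exists L, lab.
Qed.

End Relators.

(** * Derivability as an analytic relation *)

Section Analyticity.
Local Open Scope ring_scope.
Variables (R : realType) (X : metricType R) (x0 : X) (K : countFieldType).
Hypothesis compactX : compact [set: X].
Notation I := (@unit_interval R).
Notation sq := (@unit_square R).
Implicit Types (T : seq (K * (R -> X))) (H : nat -> R * R -> X).

Let dflt : K * (R -> X) := (0, fun=> x0).

(** A relator whose homotopies are replaced by positions in a sequence [H]. As [K] is countable, so
    are the patterns: the discrete part of a certificate can be held fixed while [H] varies. *)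
Let pattern := (K * nat * nat * bool)%type.

Definition instance H (r : pattern) : relator X K :=
  let: (q, i, j, b) := r in (q, H i, H j, b).

Definition pattern_terms H (L : seq pattern) :=
  flatten [seq relator_terms (instance H r) | r <- L].

Definition valid_pattern H (L : seq pattern) := (forall i, is_homotopy (H i)) /\
  forall r, r \in L -> r.2 -> H r.1.1.2 (1, 0) = H r.1.2 (0, 0).

Lemma derivable_pattern T : derivable x0 T <-> exists L lab H,
  valid_pattern H L /\ balanced x0 lab (pattern_terms H L ++ T).
Proof.
split=> [[L [lab [vL bL]]]|[L [lab [H [[hH hL] bL]]]]]; last first.
  exists [seq instance H r | r <- L], lab; split.
    move=> _ /mapP[[[[q i] j] b] rL ->]; split; [exact: hH|exact: hH|].
    exact: (hL _ rL).
  by rewrite -map_comp.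
pose S := flatten [seq [:: r.1.1.2; r.1.2] | r <- L].
pose H := nth (fun=> x0) S.
have mem1 r : r \in L -> r.1.1.2 \in S.
  by move=> rL; apply/flatten_mapP; exists r => //; rewrite mem_head.
have mem2 r : r \in L -> r.1.2 \in S.
  by move=> rL; apply/flatten_mapP; exists r => //; rewrite !inE eqxx orbT.
have homS h : h \in S -> is_homotopy h.
  move=> /flatten_mapP[[[[q h1] h2] b] /vL[v1 v2 _]].
  by rewrite !inE => /orP[] /eqP ->.
have homcst : is_homotopy (fun _ : R * R => x0).
  by split=> //; apply: continuous_subspaceT => p; exact: cvg_cst.
pose enc (r : relator X K) : pattern := (r.1.1.1, index r.1.1.2 S, index r.1.2
  S, r.2).
have encK r : r \in L -> instance H (enc r) = r.
  move=> rL; move: (mem1 _ rL) (mem2 _ rL); case: r rL => [[[q h1] h2] b] rL /=.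
  by move=> m1 m2; rewrite /H !nth_index.
exists [seq enc r | r <- L], lab, H; split; last first.
  rewrite /pattern_terms -map_comp (_ : [seq _ | r <- L] = [seq relator_terms
    r | r <- L])//.
  by apply/eq_in_map => r rL; exact: (congr1 (fun r => relator_terms r) (encK
    r rL)).
split=> [i|_ /mapP[r rL ->] /= b].
  have [iS|iS] := ltnP i (size S); last by rewrite /H nth_default.
  by apply: homS; exact: mem_nth.
rewrite /H !nth_index ?mem1 ?mem2//.
by case: r rL b => [[[q h1] h2] b] /vL[_ _].
Qed.

Definition converges (Ts : nat -> seq (K * (R -> X))) T :=
  (forall k, [seq p.1 | p <- Ts k] = [seq p.1 | p <- T]) /\
  forall u t, I t -> forall e : R, 0 < e -> exists N, forall k, (N <= k)%N ->
    mdist ((nth dflt (Ts k) u).2 t) ((nth dflt T u).2 t) < e.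

Lemma converges_size Ts T k : converges Ts T -> size (Ts k) = size T.
Proof. by move=> [/(_ k)/(congr1 size)]; rewrite !size_map. Qed.

Lemma converges_cat Ts T Ts' T' : converges Ts T -> converges Ts' T' ->
  converges (fun k => Ts k ++ Ts' k) (T ++ T').
Proof.
move=> cT cT'; split=> [k|u t It e e0].
  by rewrite !map_cat cT.1 cT'.1.
have [N NP] := cT.2 u _ It _ e0.
have [N' N'P] := cT'.2 (u - size T)%N _ It _ e0.
exists (maxn N N') => k; rewrite geq_max => /andP[Nk N'k].
rewrite !nth_cat (converges_size k cT); case: ifP => _; first exact: NP.
exact: N'P.
Qed.

Lemma converges_nil : converges (fun=> [::]) [::].
Proof.
split=> // u t It e e0; exists 0%N => k _.
by rewrite !nth_nil mdistxx.
Qed.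

Lemma converges_cons q (f : nat -> R -> X) g Ts T :
  (forall t, I t -> forall e : R, 0 < e -> exists N, forall k, (N <= k)%N ->
    mdist (f k t) (g t) < e) -> converges Ts T ->
  converges (fun k => (q, f k) :: Ts k) ((q, g) :: T).
Proof.
move=> fg cT; split=> [k|[|u] t It e e0 /=].
- by rewrite /= cT.1.
- exact: fg.
- exact: (cT.2 u).
Qed.

(** Equalities of values pass to pointwise limits, and the coefficients do not change. *)
Lemma converges_balanced Ts T lab : converges Ts T ->
  (forall k, balanced x0 lab (Ts k)) -> balanced x0 lab T.
Proof.
move=> cT bT; split=> [u v uT vT uv t It|l].
  apply: (limit_eq (cT.2 u _ It) (cT.2 v _ It)) => e e0; exists 0%N => k _.
  by rewrite ((bT k).1 u v) ?mdistxx// (converges_size k cT).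
rewrite -[RHS]((bT 0%N).2 l) (converges_size 0 cT); apply: eq_bigr => u _.
rewrite -[(nth _ T u).1](nth_map dflt 0 (fun p => p.1))//.
by rewrite -(cT.1 0%N) (nth_map dflt)// (converges_size 0 cT).
Qed.

Lemma converges_pattern (Hs : nat -> nat -> R * R -> X) H (L : seq pattern) :
  (forall i p, sq p -> forall e : R, 0 < e -> exists N, forall k, (N <= k)%N ->
    mdist (Hs k i p) (H i p) < e) ->
  converges (fun k => pattern_terms (Hs k) L) (pattern_terms H L).
Proof.
move=> cH; elim: L => [|[[[q i] j] b] L IH]; first exact: converges_nil.
apply: (@converges_cat (fun k => relator_terms (instance (Hs k) (q, i, j, b)))
  (relator_terms (instance H (q, i, j, b)))) IH.
have c0 l t : I t -> forall e : R, 0 < e -> exists N, forall k, (N <= k)%N ->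
    mdist (Hs k l (t, 0)) (H l (t, 0)) < e.
  by move=> It; apply: cH; split=> //=; exact: unit0.
have c1 l t : I t -> forall e : R, 0 < e -> exists N, forall k, (N <= k)%N ->
    mdist (Hs k l (t, 1)) (H l (t, 1)) < e.
  by move=> It; apply: cH; split=> //=; exact: unit1.
rewrite /relator_terms /instance; case: b; last first.
  apply: converges_cons; first exact: c0.
  by apply: converges_cons; [exact: c1|exact: converges_nil].
apply: converges_cons.
  move=> t /andP[t0 t1] e e0; rewrite /path_concat; case: (leP t 2^-1) => th.
    by apply: c0 => //; apply/andP; split; lra.
  by apply: c0 => //; apply/andP; split; lra.
apply: converges_cons; first exact: c0.
by apply: converges_cons; [exact: c0|exact: converges_nil].
Qed.

Lemma limit_homotopy (Hs : nat -> R * R -> X) (h : R * R ->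
  X) : (forall k, is_homotopy (Hs k)) ->
  {within sq, continuous h} ->
  (forall p, sq p -> forall e : R, 0 < e -> exists N, forall k, (N <= k)%N ->
    mdist (Hs k p) (h p) < e) -> is_homotopy h.
Proof.
move=> hH cH lH; split=> // s Is; split; (apply: limit_eq;
  [apply: lH|apply: lH|move=> e e0; exists 0%N => k _]);
  try (by split; rewrite //=; [exact: unit0|exact: unit0]);
  try (by split; rewrite //=; exact: unit1);
  try (by split; rewrite //=; exact: unit0);
  try (by split; rewrite //=; [exact: unit1|exact: unit0]).
  by have [-> _] := (hH k).2 _ Is; rewrite mdistxx.
by have [_ ->] := (hH k).2 _ Is; rewrite mdistxx.
Qed.

Variables (A : countType) (T : (nat -> A) -> seq (K * (R -> X))) (c : seq K).
Hypothesis Tc : forall a, [seq p.1 | p <- T a] = c.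
Hypothesis Tmod : forall k (a b : nat -> A), (forall i, (i < k)%N ->
  a i = b i) ->
  forall u t, I t ->
  mdist ((nth dflt (T a) u).2 t) ((nth dflt (T b) u).2 t) <= 2 / k.+1%:R.

(** The relation between [a] and its certificates is closed, since homotopies converge uniformly
    along a branch of covers; [analytic_baire] applies. *)
Theorem derivable_baire : exists D : nat -> set (seq A),
  (forall n, dense_strings (D n)) /\
  forall a, generic D a -> derivable x0 (T a) ->
  exists m, forall b, generic D b -> (forall i, (i < m)%N -> b i = a i) ->
  derivable x0 (T b).
Proof.
have /choice[Cov CovP] : forall k : nat, exists Cov : nat -> set (R * R -> X),
    (forall h, {within sq, continuous h} -> exists n, Cov n h) /\
    (forall n h h' p, sq p -> Cov n h -> Cov n h' ->
       mdist (h p) (h' p) < k.+1%:R^-1).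
  by move=> k; apply: (countable_cover_square x0 compactX); rewrite invr_gt0.
pose Y := (seq pattern * seq nat * (nat -> R * R -> X))%type.
pose C a : set Y := [set y | valid_pattern y.2 y.1.1 /\
  balanced x0 y.1.2 (pattern_terms y.2 y.1.1 ++ T a)].
(* An index fixes the pattern list and the labels exactly, and the homotopies at positions up to [k]
   within 1/(k+1). *)
pose B k n : set Y := [set y | exists codes : seq nat,
  unpickle n = Some (y.1, codes) /\
  forall i, (i <= k)%N -> Cov k (nth 0%N codes i) (y.2 i)].
have CE a : derivable x0 (T a) <-> exists y, C a y.
  rewrite derivable_pattern; split=> [[L [lab [H h]]]|[[[L lab] H] h]].
    by exists (L, lab, H).
  by exists L, lab, H.
have [k a y [[hy _] _]|a x xP|D [dD DP]] := @analytic_baire A Y B C.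
- have /choice[code codeP] : forall i, exists n, Cov k n (y.2 i).
    by move=> i; apply: (CovP k).1; have [] := hy i.
  exists (pickle (y.1, mkseq code k.+1)); exists (mkseq code k.+1).
  by rewrite pickleK; split=> // i ik; rewrite nth_mkseq.
- have {xP}/choice[z zP] : forall k, exists z : (nat -> A) * Y, [/\
      forall i, (i < k)%N -> z.1 i = a i,
      forall i, (i < k)%N -> B i (x i) z.2 & C z.1 z.2].
    by move=> k; have [a' [y [h1 h2 h3]]] := xP k; exists (a', y).
  (* The shift places the k-th approximation in the cells of levels 0 to [k]; level 0 alone forces
     its pattern list and labels to be [L] and [lab]. *)
  pose b k := (z k.+1).1; pose Hs k := (z k.+1).2.2.
  pose L := (z 1%N).2.1.1; pose lab := (z 1%N).2.1.2.
  have zL k : (z k.+1).2.1 = (L, lab).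
    have [_ /(_ 0%N isT)[c1 [e1 _]] _] := zP k.+1.
    have [_ /(_ 0%N isT)[c2 [e2 _]] _] := zP 1%N.
    by move: e1; rewrite e2 => -[<- _]; exact: surjective_pairing.
  have Cz k : valid_pattern (Hs k) L /\
      balanced x0 lab (pattern_terms (Hs k) L ++ T (b k)).
    by have [_ _ []] := zP k.+1; rewrite zL.
  have cauchy i j k l p : (i <= j)%N -> (j <= k)%N -> (j <= l)%N -> sq p ->
      mdist (Hs k i p) (Hs l i p) < j.+1%:R^-1.
    move=> ij jk jl Ip.
    have [_ /(_ j jk)[c1 [e1 /(_ i ij) h1]] _] := zP k.+1.
    have [_ /(_ j jl)[c2 [e2 /(_ i ij) h2]] _] := zP l.+1.
    move: e2 h2; rewrite e1 => -[_ <-] h2; exact: ((CovP j).2 _ _ _ _ Ip h1 h2).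
  have /choice[H HP] : forall i, exists h, {within sq, continuous h} /\
      forall p, sq p -> forall e : R, 0 < e -> exists N, forall k, (N <= k)%N ->
      mdist (Hs k i p) (h p) < e.
    move=> i; have [|e e0|h ch hl] := @uniform_limit _ _ compactX _ sq
      (fun k => Hs k i); last by exists h.
      by move=> k; have [[hH _] _] := Cz k; have [] := hH i.
    have [N NP] := inv_lt e0; exists (maxn N i) => k l p Nk Nl Ip.
    apply: lt_trans (NP (maxn N i) _); last exact: leq_maxl.
    by apply: cauchy Ip => //; exact: leq_maxr.
  exists ((L, lab), H); split=> /=.
    split=> [i|r rL rb].
      apply: (@limit_homotopy (fun k => Hs k i));
        [|exact: (HP i).1|exact: (HP i).2].
      by move=> k; have [[hH _] _] := Cz k.
    have s10 : sq (1, 0) by split; [exact: unit1|exact: unit0].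
    have s00 : sq (0, 0) by split; exact: unit0.
    apply: (limit_eq ((HP _).2 _ s10) ((HP _).2 _ s00)) => e e0.
    by exists 0%N => k _; have [[_ /(_ r rL rb) ->] _] := Cz k; rewrite mdistxx.
  apply: (@converges_balanced (fun k => pattern_terms (Hs k) L ++ T (b k)));
    last by move=> k; have [] := Cz k.
  apply: converges_cat.
    by apply: converges_pattern => i; exact: (HP i).2.
  split=> [k|u t It e e0]; first by rewrite !Tc.
  have [N NP] := inv_lt (divr_gt0 e0 (ltr0Sn _ 1)); exists N => k Nk.
  apply: le_lt_trans (@Tmod k _ _ _ u _ It) _.
    by move=> i ik; have [h _ _] := zP k.+1; apply: h; exact: leqW.
  by rewrite mulrC -ltr_pdivlMr//; exact: NP.
- exists D; split=> // a ga /CE da; have [m mP] := DP _ ga da.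
  by exists m => a' ga' a'a; apply/CE; exact: mP.
Qed.

End Analyticity.

(** * Continuum many linearly independent loops *)

Section IndependentLoops.
Local Open Scope ring_scope.
Variables (R : realType) (X : metricType R) (K : countFieldType).
Variables (x0 : X) (gam : nat -> R -> X) (phi : nat -> (R -> X) -> K).
Hypothesis compactX : compact [set: X].
Notation I := (@unit_interval R).
Hypothesis gamP : forall n, is_loop x0 (gam n).
Hypothesis gam_small : forall n t, I t -> mdist x0 (gam n t) < n.+1%:R^-1.
Hypothesis phiP : forall n, path_additive (phi n).
Hypothesis phi_gam : forall n, phi n (gam n) != 0.

Let cat := @infinite_concat R X x0 gam compactX gamP gam_small 0.

(** The [size c] binary sequences are merged into one sequence of tuples, so that genericity
    concerns them jointly. *)
Definition combination (c : seq K) (a : nat -> (size c).-tuple bool) :=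
  mkseq (fun i => (nth 0 c i, cat (fun m => nth false (a m) i))) (size c).

Lemma eval_combination F c (a : nat -> (size c).-tuple bool) :
  eval F (combination a) =
  \sum_(i < size c) nth 0 c i * F (cat (fun m => nth false (a m) i)).
Proof.
by rewrite /eval /combination /mkseq big_map -{1}[size c]subn0 -/(index_iota 0
  _) big_mkord.
Qed.

Lemma combination_paths c (a : nat -> (size c).-tuple bool) :
  all_paths (combination a).
Proof. by move=> p /mapP[i _ ->]; exact: infinite_concat_path. Qed.

Lemma generic_not_derivable c i : (i < size c)%N -> nth 0 c i != 0 ->
  exists D : nat -> set (seq ((size c).-tuple bool)),
    (forall n, dense_strings (D n)) /\
    forall a, generic D a -> ~ derivable x0 (combination a).
Proof.
move=> ic ci; have [a|k a b ab u t It|D [dD DP]] := @derivable_baire R X x0 K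
    compactX _ (@combination c) c.
- by rewrite /combination /mkseq -map_comp; exact: mkseq_nth.
- have [uc|uc] := ltnP u (size c); last first.
    by rewrite !nth_default ?size_mkseq// mdistxx divr_ge0.
  rewrite !nth_mkseq//=; apply: infinite_concat_modulus => // j jk.
  by rewrite ab.
have [D' [dD' D'P]] := generic_update dD.
exists D'; split=> // a /D'P[ga gu] da; have [m mP] := DP _ ga da.
(* Changing one late bit of the i-th sequence preserves derivability, but changes
   the value of [phi m] by [c_i * phi m (gam m)]. *)
pose flip b : (size c).-tuple bool :=
  [tuple if j == i :> nat then b else tnth (a m) j | j < size c].
have ev b : eval (phi m) (combination (update a m (flip b))) = 0.
  apply: (eval_derivable (phiP m) (@combination_paths c _)).
  apply: mP; first exact: gu.
  by move=> j jm; rewrite /update ltn_eqF.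
have := ev true; rewrite -(ev false) !eval_combination.
pose i0 := Ordinal ic; rewrite (bigD1 i0)//= [RHS](bigD1 i0)//=.
have comp b : (fun k => nth false (update a m (flip b) k) i) =
    update (fun k => nth false (a k) i) m b.
  apply/funext => k; rewrite /update; case: eqP => // _.
  by rewrite -[i]/(val i0) -tnth_nth tnth_mktuple /= eqxx.
rewrite !comp /cat additive_infinite_concat_update; last exact: phiP.
rewrite (eq_bigr (fun j : 'I_(size c) => nth 0 c j *
    phi m (cat (fun k => nth false (update a m (flip false) k) j)))) /cat.
  move/addIr/eqP; rewrite mulrDr -subr_eq0 addrC addKr mulf_eq0 (negbTE ci).
  exact/negP/phi_gam.
move=> j ji; congr (_ * phi m (infinite_concat _ _ _ _ _)).
apply/funext => k; rewrite /update; case: eqP => // _.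
by rewrite -!tnth_nth !tnth_mktuple; rewrite -val_eqE in ji;
  rewrite (negbTE ji).
Qed.

(** Distinct members of the family from [perfect_generic] are jointly generic, so no combination of
    them with a nonzero coefficient is derivable. Their loops are thus independent modulo
    [relation_space], and [linear_extension] prescribes the values. *)
Theorem independent_loops : exists2 g : (nat -> bool) -> R -> X,
  forall alpha, is_loop x0 (g alpha) &
  forall u : (nat -> bool) -> K, exists2 F, path_additive F &
    forall alpha, F (g alpha) = u alpha.
Proof.
(* One family of dense sets per coefficient list; there are countably many lists because [K] is
   countable. *)
have fam (c : seq K) : exists D : nat -> set (seq ((size c).-tuple bool)),
    (forall n, dense_strings (D n)) /\ forall i, (i < size c)%N ->
    nth 0 c i != 0 -> forall a, generic D a -> ~ derivable x0 (combination a).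
  have [[i [ic ci]]|nc] := pselect (exists i, (i < size c)%N /\ nth 0 c i != 0).
    by have [D [dD DP]] := generic_not_derivable ic ci; exists D.
  exists (fun=> setT); split=> [n p|i ic ci].
    by exists p => //; exact: prefix_refl.
  by case: nc; exists i.
pose DD c := projT1 (cid (fam c)).
have DDP c := projT2 (cid (fam c)).
(* Enumerates the pairs of a coefficient list and an index in its family. *)
pose cm j : seq K * nat := odflt ([::], 0%N) (unpickle j).
have [|A AP] := @perfect_generic (fun j => size (cm j).1)
    (fun j => DD (cm j).1 (cm j).2).
  by move=> j; have [+ _] := DDP (cm j).1; exact.
exists (fun alpha => cat (A alpha)) => [alpha|u].
  exact: infinite_concat_loop.
have [|L [Llin LW Lu]] := @linear_extension K _ (nat ->
  bool) (relation_space (K := K))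
  (fun alpha => delta K (cat (A alpha))) u
  (@relation_space0 R X K) (@relation_space_linear R X K).
  move=> s c us Ws alpha alphas; apply: contrapT => /eqP c0.
  have sc : size [seq c a | a <- s] = size s by rewrite size_map.
  pose al (j : 'I_(size [seq c a | a <- s])) := nth alpha s j.
  have alI : injective al.
    move=> j j' /eqP; rewrite nth_uniq// -?sc// => /eqP jj'.
    exact: val_inj.
  have is_lt : (index alpha s < size [seq c a | a <- s])%N by rewrite sc
    index_mem.
  have is_nz : nth 0 [seq c a | a <- s] (index alpha s) != 0.
    by rewrite (nth_map alpha) ?index_mem// nth_index.
  have [_ /(_ _ is_lt is_nz) h] := DDP [seq c a | a <- s].
  apply: (h (fun k => [tuple A (al j) k | j < size [seq c a | a <- s]])).
    move=> n; pose j := pickle ([seq c a | a <- s], n).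
    have := AP j; rewrite /cm /j pickleK /=; exact.
  have -> : combination (fun k => [tuple A (al j) k | j < size [seq c a | a <-
    s]])
      = [seq (c a, cat (A a)) | a <- s].
    apply: (@eq_from_nth _ (0, fun=> x0)); first by rewrite size_mkseq
      !size_map.
    move=> i; rewrite size_mkseq => ic; have is_ : (i < size s)%N by rewrite
      -sc.
    rewrite nth_mkseq// !(nth_map alpha)//; congr (_, cat _).
    apply/funext => k; rewrite -[i]/(val (Ordinal ic)) -tnth_nth tnth_mktuple.
    by [].
  by apply: derivable_of_relation; rewrite /formal big_map.
by exists (L \o delta K) => //; exact: linear_additive.
Qed.

End IndependentLoops.

(** * Counting homomorphisms *)

Section Dichotomy.
Local Open Scope ring_scope.
Variables (R : realType) (X : metricType R) (x0 : X) (K : countFieldType).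
Hypothesis peanoX : peano_continuum X.
Notation I := (@unit_interval R).

Let compactX : compact [set: X]. Proof. by case: peanoX. Qed.

Lemma inj_image_card_le (S U : Type) (A : set S) (B : set U) (f : S -> U) :
  {in A &, injective f} -> f @` A `<=` B -> (A #<= B)%card.
Proof.
move=> /inj_card_eq fA fB; apply: card_le_trans (subset_card_le fB).
by move: fA; rewrite card_eq_sym card_eq_le => /andP[].
Qed.

(** The centres of ever smaller closed paths with nonzero value cluster at some [x1]. A path in a
    small path connected neighbourhood of [x1] turns such a closed path into a loop at [x1] with the
    same value. *)
Lemma small_essential_loops :
  ~ (exists2 d : R, 0 < d & small_loops_vanish X K d) ->
  exists x1 : X, exists (gam : nat -> R -> X) (phi : nat -> (R -> X) -> K),
    forall n, [/\ is_loop x1 (gam n),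
      forall t, I t -> mdist x1 (gam n t) < n.+1%:R^-1,
      path_additive (phi n) & phi n (gam n) != 0].
Proof.
move=> nd; have [_ _ lpc] := peanoX.
have /choice[z zP] : forall n : nat, exists z : X * (R -> X) * ((R -> X) -> K),
    [/\ is_path z.1.2, z.1.2 0 = z.1.2 1,
        forall t, I t -> mdist z.1.1 (z.1.2 t) < n.+1%:R^-1,
        path_additive z.2 & z.2 z.1.2 != 0].
  move=> n; apply: contrapT => h; apply: nd; exists n.+1%:R^-1.
    by rewrite invr_gt0.
  move=> f x pf f01 fx F addF; apply: contrapT => /eqP Ff; apply: h.
  by exists (x, f, F).
have [|x1 _ cx] := @cluster_seq _ _ _ (fun n => (z n).1.1) compactX;
  first by [].
have /choice[y yP] : forall n : nat, exists y : (R -> X) * ((R -> X) -> K),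
    [/\ is_loop x1 y.1, forall t, I t -> mdist x1 (y.1 t) < n.+1%:R^-1,
        path_additive y.2 & y.2 y.1 != 0].
  move=> n; have n0 : 0 < n.+1%:R^-1 :> R by rewrite invr_gt0.
  have [V [oV Vx Vn Vpc]] := lpc _ _ (nbhsx_ballx x1 _ n0).
  have /nbhs_ballP[r /= r0 rV] := open_nbhs_nbhs (conj oV Vx).
  have r20 : 0 < r / 2 by rewrite divr_gt0.
  have [N NP] := inv_lt r20.
  (* [m] is large enough for the m-th closed path to lie in the ball of radius [r] about [x1], hence
     in [V]. *)
  have [m Nm] := cx _ r20 N; rewrite ballEmdist/= => xm.
  have [pf f01 fm addF Ff] := zP m; set f := (z m).1.2 in pf f01 fm Ff.
  have fV t : I t -> V (f t).
    move=> It; apply: rV; rewrite ballEmdist/= [r]splitr.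
    by apply: mdist_lt xm _; apply: lt_trans (fm _ It) _; exact: NP.
  have [tau [pt t0 t1 tV]] := Vpc _ _ Vx (fV _ (@unit0 R)).
  exists (path_concat (path_concat tau f) (rev_path tau), (z m).2);
    split => //=.
  - split; last by rewrite path_concat1 /rev_path subrr.
      apply: is_path_concat; [by apply: is_path_concat|exact: is_path_rev|].
      by rewrite path_concat1 /rev_path subr0 t1.
    by rewrite !path_concat0.
  - move=> t It; suff /Vn : V (path_concat (path_concat tau f) (rev_path tau)
    t).
      by rewrite ballEmdist.
    apply: path_concat_all It; first exact: path_concat_all.
    exact: rev_path_all.
  - rewrite addF.1 ?(addF.1 tau)// ?(additive_rev addF)//.
    + by rewrite addrAC subrr add0r.
    + exact: is_path_concat.
    + exact: is_path_rev.
    + by rewrite path_concat1 /rev_path subr0 t1.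
by exists x1, (fun n => (y n).1), (fun n => (y n).2) => n; exact: yP.
Qed.

(** Conjugation by [beta] carries the independent loops to [x0] without changing values; each set of
    binary sequences is then recovered from a homomorphism equal to its indicator on these loops. *)
Lemma many_homs : ~ (exists2 d : R, 0 < d & small_loops_vanish X K d) ->
  ([set: set (set nat)] #<= @pi1_hom R X x0 K)%card.
Proof.
move=> /small_essential_loops[x1 [gam [phi gP]]].
have gl n : is_loop x1 (gam n) by have [] := gP n.
have gs n t : I t -> mdist x1 (gam n t) < n.+1%:R^-1 by have [_ + _ _] :=
  gP n; exact.
have addphi n : path_additive (phi n) by have [] := gP n.
have phig n : phi n (gam n) != 0 by have [] := gP n.
have [g lg gP'] := independent_loops compactX gl gs addphi phig.
have [_ pcX _] := peanoX.
have [//|//|beta [pb b0 b1 _]] := pcX x0 x1.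
pose l al := path_concat (path_concat beta (g al)) (rev_path beta).
have ll al : is_loop x0 (l al).
  have [pg g0 g1] := lg al; split; last by rewrite /l path_concat1 /rev_path
    subrr.
    apply: is_path_concat; [|exact: is_path_rev|].
      by apply: is_path_concat => //; rewrite b1.
    by rewrite path_concat1 /rev_path subr0 g1.
  by rewrite /l !path_concat0.
have /choice[psi psiP] : forall u : (nat -> bool) -> K, exists psi,
    pi1_hom psi /\ forall al, psi (pi1_of (ll al)) = u al.
  move=> u; have [F addF Fu] := gP' u.
  have [psi hpsi psiE] := hom_of_additive x0 addF.
  exists psi; split=> // al; have [pg g0 g1] := lg al.
  rewrite psiE additive_closed// ?Fu; first by rewrite addrAC subrr add0r.
  - by rewrite b1.
  - by rewrite g1.
pose u (S : set (set nat)) : (nat -> bool) -> K :=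
  fun al => (`[< S [set n | al n] >])%:R.
apply: (@inj_image_card_le _ _ _ _ (psi \o u)); last first.
  by move=> _ [S _ <-]; have [] := psiP (u S).
move=> S S' _ _ /= SS'; apply/seteqP; split=> A;
  rewrite (_ : A = [set n | `[< A n >]]).
- move=> SA; have := (psiP (u S')).2 (fun n => `[< A n >]).
  rewrite -SS' (psiP (u S)).2 /u asboolT//; case: asboolP => // _.
  by move=> /eqP; rewrite oner_eq0.
- by apply/seteqP; split=> n /asboolP.
- move=> SA; have := (psiP (u S)).2 (fun n => `[< A n >]).
  rewrite SS' (psiP (u S')).2 /u asboolT//; case: asboolP => // _.
  by move=> /eqP; rewrite oner_eq0.
- by apply/seteqP; split=> n /asboolP.
Qed.

(** A path, seen as a map of the square constant in the second variable, is determined on [0,1] by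
    the cells of the countable covers that contain it. *)
Lemma pi1_code : exists code : pi1 R x0 -> set nat, injective code.
Proof.
have /choice[Cov CovP] : forall k : nat, exists Cov : nat -> set (R * R -> X),
    (forall h, {within @unit_square R, continuous h} -> exists n, Cov n h) /\
    (forall n h h' p, unit_square p -> Cov n h -> Cov n h' ->
       mdist (h p) (h' p) < k.+1%:R^-1).
  by move=> k; apply: (countable_cover_square x0 compactX); rewrite invr_gt0.
have /choice[r rP] : forall a : pi1 R x0, exists f,
    exists h : is_loop x0 f, a = pi1_of h.
  by move=> a; exact: pi1_ofP.
exists (fun a => [set n | if unpickle n is Some (k, c) then
  Cov k c (r a \o fst) else False]) => a b ab.
have [la aE] := rP a; have [lb bE] := rP b; rewrite aE bE.
have [pa _ _] := la; have [pb _ _] := lb.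
apply: eq_exist; apply/eq_loop_class => //; apply: homotopic_eq => // t It.
apply: mdist_positivity; apply/eqP; rewrite eq_le mdist_ge0 andbT.
apply/ler_addgt0Pl => e e0; rewrite addr0; have [N NP] := inv_lt e0.
have [|c cP] := (CovP N).1 (r a \o fst).
  by apply: within_comp pa => [p|p []//]; exact: cvg_fst.
have : [set n | if unpickle n is Some (k, c) then Cov k c (r a \o fst) else
  False]
  (pickle (N, c)) by rewrite /= pickleK.
rewrite ab /= pickleK => cP'; apply: ltW; apply: lt_trans (NP N (leqnn N)).
have It0 : @unit_square R (t, 0) by split=> //; exact: unit0.
exact: ((CovP N).2 _ _ _ _ It0 cP cP').
Qed.

Lemma few_homs : (@pi1_hom R X x0 K #<= [set: set (set nat)])%card.
Proof.
have [code codeI] := pi1_code.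
(* [S a q] encodes the pair [(a, q)], so a homomorphism is encoded by its graph. *)
pose S (a : pi1 R x0) (q : K) : set nat := [set m |
  match (unpickle m : option (nat + K)%type) with
  | Some (inl n) => code a n | Some (inr q') => q' = q | None => False end].
have SI a q b q' : S a q = S b q' -> a = b /\ q = q'.
  move=> e; split.
    apply: codeI; apply/seteqP; split=> n cn.
      have : S a q (pickle (inl n : (nat + K)%type)) by rewrite /S /= pickleK.
      by rewrite e /S /= pickleK.
    have : S b q' (pickle (inl n : (nat + K)%type)) by rewrite /S /= pickleK.
    by rewrite -e /S /= pickleK.
  have : S a q (pickle (inr q : (nat + K)%type)) by rewrite /S /= pickleK.
  by rewrite e /S /= pickleK.
apply: (@inj_image_card_le _ _ _ _ (fun psi => [set A | exists a, A = S a (psi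
  a)])).
  move=> psi psi' _ _ e; apply/funext => a.
  have : [set A | exists a, A = S a (psi a)] (S a (psi a)) by exists a.
  by rewrite e => -[b /SI[-> ->]].
by [].
Qed.

Theorem hom_dichotomy : (exists n, exists f : (pi1 R x0 -> K) ->
    {ffun 'I_n * 'I_n -> K}, {in @pi1_hom R X x0 K &, injective f}) \/
  (@pi1_hom R X x0 K #= [set: set (set nat)])%card.
Proof.
have [[d d0 small]|nd] := pselect (exists2 d : R, 0 < d & small_loops_vanish X
  K d).
  by left; exact: hom_small small.
by right; rewrite card_eq_le few_homs many_homs.
Qed.

End Dichotomy.

Theorem theorem3p7 (R : realType) (X : metricType R) (x0 : X) (p : nat) :
  peano_continuum X -> prime p ->
  (finite_set (@pi1_hom R _ x0 ('Z_p : zmodType)) \/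
     (@pi1_hom R _ x0 ('Z_p : zmodType) #= [set: set (set nat)])%card) /\
  (countable (@pi1_hom R _ x0 (rat : zmodType)) \/
     (@pi1_hom R _ x0 (rat : zmodType) #= [set: set (set nat)])%card).
Proof.
move=> pX pp; split; last first.
  have [[n [f fI]]|] := @hom_dichotomy R X x0 rat pX; last by right.
  left; apply: sub_countable (countableP [set: {ffun 'I_n * 'I_n -> rat}]).
  exact: inj_image_card_le fI _.
(* The dichotomy needs a field: it is applied to ['F_p], which becomes ['Z_p] on rewriting [pdiv p]
   to [p]. *)
have : finite_set (@pi1_hom R _ x0 ('F_p : zmodType)) \/
    (@pi1_hom R _ x0 ('F_p : zmodType) #= [set: set (set nat)])%card.
  have [[n [f fI]]|] := @hom_dichotomy R X x0 'F_p pX; last by right.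
  left; apply: card_le_finite (@finite_finset {ffun 'I_n * 'I_n -> 'F_p} setT).
  exact: inj_image_card_le fI _.
by rewrite (pdiv_id pp).
Qed.
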